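(* Let $n\ge 1$ and $\Delta\ge 1$, and let $G_1=(V,E_1)$ and $G_2=(V,E_2)$ be graphs on a common $n$-vertex set $V$, each of maximum degree at most $\Delta$. Let $m=|E_1\cup E_2|$ and let $k$ be a positive integer. Then: (i) For every fixed $\delta>0$, if $k>(6+\delta)\Delta$, the Glauber dynamics for simultaneous $k$-edge-colorings of $(G_1,G_2)$ has mixing time $O(m\log n)$ (the implied constant depending only on $\delta$). (ii) There is a $6$-local choice of flip probabilities $(P_i)_{i\ge1}$ (i.e. $P_1=1$, $0\le P_i\le 1$, and $P_i=0$ for all $i\ge 7$) such that, whenever $k\ge 5.948\Delta$, the flip dynamics for simultaneous $k$-edge-colorings of $(G_1,G_2)$ with these flip probabilities has mixing time $O(m\log n)$.
   Context: A simultaneous $k$-edge-coloring of $(G_1,G_2)$ is a map $\phi:E_1\cup E_2\to[k]$ such that for each $i\in\{1,2\}$, any two distinct edges $e,e'\in E_i$ sharing an endpoint satisfy $\phi(e)\ne\phi(e')$ (edges of different graphs sharing an endpoint may have the same color). Equivalently, let $\widehat G$ be the graph with vertex set $E_1\cup E_2$ in which $e,e'$ are adjacent iff they share an endpoint and both lie in $E_1$ or both lie in $E_2$; simultaneous $k$-edge-colorings are exactly proper vertex $k$-colorings of $\widehat G$. Let $\Omega$ be the set of these colorings; the chains below have the uniform distribution on $\Omega$ as stationary distribution. Glauber dynamics: from $X_t\in\Omega$, choose $e\in E_1\cup E_2$ and $c\in[k]$ uniformly at random; if no neighbor of $e$ in $\widehat G$ has color $c$, recolor $e$ with $c$, otherwise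 stay. Flip dynamics: for a coloring $\sigma$, edge $e$ and color $c$, the cluster $S_\sigma(e,c)$ is the set of edges reachable from $e$ in $\widehat G$ by a path whose vertices alternate between colors $\sigma(e)$ and $c$ (with $S_\sigma(e,\sigma(e))=\{e\}$). Given probabilities $(P_i)$ with $P_1=1$, one step from $X_t$ chooses $(e,c)\in(E_1\cup E_2)\times[k]$ uniformly, lets $s=|S_{X_t}(e,c)|$, and with probability $P_s/s$ interchanges the colors $X_t(e)$ and $c$ on $S_{X_t}(e,c)$; otherwise stays. The mixing time is $T_{\mathrm{mix}}=\max_{X_0\in\Omega}\min\{t: d_{TV}(P^t(X_0,\cdot),\pi)\le 1/4\}$, where $\pi$ is uniform on $\Omega$ and $d_{TV}$ is total variation distance. *)

(* Defs.v *)
From HB Require Import structures.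
From mathcomp Require Import all_boot all_order all_algebra.
From mathcomp Require Import boolp classical_sets reals ereal exp.

Set Implicit Arguments.
Unset Strict Implicit.
Unset Printing Implicit Defensive.

Import Order.TTheory GRing.Theory Num.Theory.
Local Open Scope ring_scope.

Section MarkovChain.
Variables (R : realType) (T : finType).
Implicit Types (P : T -> T -> R) (mu nu : T -> R).

Fixpoint kernel_pow P (t : nat) (x y : T) : R :=
  if t is t'.+1 then \sum_(z : T) P x z * kernel_pow P t' z y
  else (x == y)%:R.

Definition uniform_dist : T -> R := fun=> #|T|%:R^-1.

Definition dTV mu nu : R := 2^-1 * \sum_(x : T) `|mu x - nu x|.

(* Extended-real valued: the infimum over the empty set is +oo, so a chain     *)
(* that never gets within 1/4 of nu has infinite mixing time.                 *)
Definition mixing_time_from P nu (x : T) : \bar R :=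
  ereal_inf [set t%:R%:E | t in [set t : nat | dTV (kernel_pow P t x) nu <= 4^-1]]%classic.

Definition mixing_time P nu : \bar R :=
  \big[maxe/0%:E]_(x : T) mixing_time_from P nu x.

End MarkovChain.

Arguments uniform_dist : clear implicits.

Section SimpleGraph.
Variable V : finType.
Implicit Types (E : {set {set V}}) (e f : {set V}).

Definition simple_graph E : Prop := forall e, e \in E -> #|e| = 2%N.

Definition degree E (v : V) : nat := #|[set e in E | v \in e]|.

Definition max_degree E : nat := (\max_(v : V) degree E v)%N.

Definition share_endpoint e f : bool := [exists v, (v \in e) && (v \in f)].

End SimpleGraph.

Section SimultaneousColoring.
Variables (V : finType) (E1 E2 : {set {set V}}) (k : nat).

Definition edge : finType := {e : {set V} | e \in E1 :|: E2}.

Definition proper_on (E : {set {set V}}) (phi : {ffun edge -> 'I_k}) : bool :=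
  [forall e : edge, forall f : edge,
    [&& e != f, val e \in E, val f \in E & share_endpoint (val e) (val f)]
      ==> (phi e != phi f)].

Definition sim_proper (phi : {ffun edge -> 'I_k}) : bool :=
  proper_on E1 phi && proper_on E2 phi.

Definition sim_coloring : finType := {phi : {ffun edge -> 'I_k} | sim_proper phi}.

(* Adjacency in the conflict graph on E1 :|: E2.                              *)
Definition hat_adj (e f : edge) : bool :=
  [&& e != f, share_endpoint (val e) (val f) &
      ((val e \in E1) && (val f \in E1)) || ((val e \in E2) && (val f \in E2))].

Lemma sim_properP (phi : {ffun edge -> 'I_k}) :
  reflect (forall e f, hat_adj e f -> phi e != phi f) (sim_proper phi).
Proof.
apply: (iffP andP) => [[/forallP p1 /forallP p2] e f | pr].
  case/and3P=> nef sh /orP[] /andP[ei fi].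
    by move/forallP: (p1 e) => /(_ f); rewrite nef ei fi sh.
  by move/forallP: (p2 e) => /(_ f); rewrite nef ei fi sh.
by split; apply/forallP => e; apply/forallP => f; apply/implyP;
  case/and4P=> nef ei fi sh; apply: pr; rewrite /hat_adj nef sh ei fi ?orbT.
Qed.

Lemma hat_adjC e f : hat_adj e f = hat_adj f e.
Proof.
rewrite /hat_adj eq_sym; congr [&& _, _ & _].
  by apply: eq_existsb => v; rewrite andbC.
by rewrite andbC [X in _ || X]andbC.
Qed.

Definition available (phi : {ffun edge -> 'I_k}) (e : edge) (c : 'I_k) : bool :=
  [forall f : edge, hat_adj e f ==> (phi f != c)].

Definition glauber_fun (phi : {ffun edge -> 'I_k}) (e : edge) (c : 'I_k) :
    {ffun edge -> 'I_k} :=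
  if available phi e c then [ffun f => if f == e then c else phi f] else phi.

Lemma glauber_fun_proper (sigma : sim_coloring) e c :
  sim_proper (glauber_fun (val sigma) e c).
Proof.
case: sigma => phi /= prp; have /sim_properP pr := prp.
rewrite /glauber_fun; case: ifP => // /forallP av.
apply/sim_properP => f g afg; rewrite !ffunE.
case: (eqVneq f e) => [fe|_]; case: (eqVneq g e) => [ge|_].
- by move: afg; rewrite fe ge /hat_adj eqxx.
- by rewrite eq_sym; apply: (implyP (av g)); rewrite -fe.
- by apply: (implyP (av f)); rewrite -ge hat_adjC.
- exact: pr.
Qed.

Definition glauber_move (sigma : sim_coloring) (e : edge) (c : 'I_k) :
  sim_coloring := Sub (glauber_fun (val sigma) e c) (glauber_fun_proper sigma e c).

Definition alternates (phi : {ffun edge -> 'I_k}) (a c : 'I_k) (f g : edge) : bool :=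
  hat_adj f g &&
  (((phi f == a) && (phi g == c)) || ((phi f == c) && (phi g == a))).

Definition flip_cluster (phi : {ffun edge -> 'I_k}) (e : edge) (c : 'I_k) : {set edge} :=
  if c == phi e then [set e]%SET
  else [set f | connect (alternates phi (phi e) c) e f]%SET.

Definition swap_color (a c x : 'I_k) : 'I_k :=
  if x == a then c else if x == c then a else x.

Definition flip_fun (phi : {ffun edge -> 'I_k}) (e : edge) (c : 'I_k) :
    {ffun edge -> 'I_k} :=
  [ffun f => if f \in flip_cluster phi e c then swap_color (phi e) c (phi f) else phi f].

Lemma flip_fun_proper (sigma : sim_coloring) e c :
  sim_proper (flip_fun (val sigma) e c).
Proof.
case: sigma => phi /= /sim_properP pr.
apply/sim_properP => f g afg; rewrite !ffunE /flip_cluster.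
have swapid x : swap_color (phi e) (phi e) x = x.
  by rewrite /swap_color; case: (eqVneq x (phi e)).
case: (eqVneq c (phi e)) => [->|nce].
  by rewrite !swapid !if_same; apply: pr.
have swap_inj x y : x != y -> swap_color (phi e) c x != swap_color (phi e) c y.
  apply: contraNN; rewrite /swap_color => /eqP.
  case: (x =P phi e) => ?; case: (x =P c) => ?; case: (y =P phi e) => ?;
    by case: (y =P c) => ? ?; apply/eqP; move/eqP: nce; congruence.
have col h : connect (alternates phi (phi e) c) e h ->
    (phi h == phi e) || (phi h == c).
  case/connectP=> p; elim/last_ind: p => [_ ->|p x _]; first by rewrite eqxx.
  rewrite rcons_path last_rcons => /andP[_ /andP[_ /orP[]]] /andP[_ hx] ->;
    by rewrite hx ?orbT.
have step x y : hat_adj x y -> connect (alternates phi (phi e) c) e x ->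
    ~~ connect (alternates phi (phi e) c) e y ->
    swap_color (phi e) c (phi x) != phi y.
  move=> axy cx; apply: contra => /eqP sxy.
  apply: (connect_trans cx (connect1 _)); rewrite /alternates axy -sxy /swap_color.
  case/orP: (col _ cx) => /eqP ->; first by rewrite !eqxx.
  by rewrite (negbTE nce) !eqxx orbT.
rewrite !inE; case: ifPn => cf; case: ifPn => cg.
- exact/swap_inj/pr.
- exact: step.
- by rewrite eq_sym; apply: step cg cf; rewrite hat_adjC.
- exact: pr.
Qed.

Definition flip_move (sigma : sim_coloring) (e : edge) (c : 'I_k) :
  sim_coloring := Sub (flip_fun (val sigma) e c) (flip_fun_proper sigma e c).

Variable R : realType.

(* When E1 :|: E2 is empty there is no edge to choose and the kernels below    *)
(* vanish; the only coloring is then the empty one, so that the mixing time,  *)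
(* reached at t = 0, is 0 regardless.                                         *)
Definition glauber_kernel (sigma tau : sim_coloring) : R :=
  \sum_(e : edge) \sum_(c < k)
    (#|E1 :|: E2| * k)%:R^-1 * (glauber_move sigma e c == tau)%:R.

Definition flip_kernel (p : nat -> R) (sigma tau : sim_coloring) : R :=
  \sum_(e : edge) \sum_(c < k)
    (#|E1 :|: E2| * k)%:R^-1 *
    (let s := #|flip_cluster (val sigma) e c| in
     p s / s%:R * (flip_move sigma e c == tau)%:R
     + (1 - p s / s%:R) * (sigma == tau)%:R).

Definition glauber_mixing_time : \bar R :=
  mixing_time glauber_kernel (uniform_dist R sim_coloring).

Definition flip_mixing_time (p : nat -> R) : \bar R :=
  mixing_time (flip_kernel p) (uniform_dist R sim_coloring).

End SimultaneousColoring.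

Definition local_flip_probs (R : realType) (l : nat) (p : nat -> R) : Prop :=
  [/\ p 1%N = 1,
      forall i, (1 <= i)%N -> 0 <= p i <= 1
    & forall i, (l < i)%N -> p i = 0].

(* Main.v *)
Require Import Defs.
From mathcomp Require Import all_boot all_order all_algebra.
From mathcomp Require Import boolp reals ereal sequences exp.
From mathcomp Require Import ring lra.

Set Implicit Arguments.
Unset Strict Implicit.
Unset Printing Implicit Defensive.

Import Order.TTheory GRing.Theory Num.Theory.
Local Open Scope ring_scope.

(* Path coupling in dual form: both dynamics extend to all maps edge -> 'I_k,  *)
(* proper or not, and one step is shown to contract, by a factor               *)
(* 1 - eta / m, the Lipschitz constant of every test function for a weighted   *)
(* Hamming distance. Weighted Hamming distance is a path metric on all maps,   *)
(* so it suffices to compare X and Y that differ at a single edge v.           *)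
(* Edges lying in both graphs have weight 1, the others a weight w close to    *)
(* 1/2: a common edge may conflict with 4 Delta edges, but then none of these  *)
(* is common. With w = 1/2 and singleton flips only (Glauber dynamics) each    *)
(* colour seen around v costs its availability and one disagreement per        *)
(* neighbour, which gives 6 Delta. The bottleneck is a colour seen exactly     *)
(* once, on clusters all of whose other edges are heavy; coupling the flip of  *)
(* the two-edge cluster at v with the flip of the neighbour alone then gains   *)
(* p_2, while the larger clusters lose at most the largest (b - 1) q_b, where  *)
(* q_b = p_b - p_(b+1). Choosing (b - 1) q_b almost constant makes the gain    *)
(* exceed the loss. For every other colour pattern crude bounds are enough.    *)

(** Glauber dynamics is the flip dynamics with [p a = [a = 1]] ([glauber_kernelE]), so one argument,
    parametrised by [p], serves both parts. Let m be the number of edges. One step acts on functions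
    by [flip_step p f = f + flip_drift p f / (m k)]. Let X and Y differ only at v, let f be
    1-Lipschitz for the weighted Hamming distance, and write W for the weight of v and F = f X - f
    Y, so that the slack W - F is nonnegative.

    A move whose cluster avoids v in both maps is the same move in both, and it adds at most the
    slack to the difference of the drifts ([drift_split], [good_drift]). The other moves are grouped
    by the colour c that v would receive. Together they add at most one slack for each edge of the
    X-cluster of v, plus a budget for each neighbour coloured c, minus W ([color_drift]). Summed up,
    the slack occurs m k times, the budgets are at most kappa Delta W ([sum_budget]), and k copies
    of W are gained. If kappa Delta <= (1 - eta) k, one step therefore turns F into at most (1 - eta
    / m) W ([drift_contract], [flip_step_adjacent]).

    Interpolating between arbitrary maps ([cdist_pathP]), iterating, and testing against the sign of
    the deviation from uniformity gives total variation at most (m / w) (1 - eta / m)^t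
    ([dTV_flip_le]), hence O(m log n), as m <= n^2. The numerical conditions on [p] are collected in
    [contractive]; they hold with kappa = 6 for Glauber dynamics and kappa = 5.946 for a 6-local
    choice. *)

Section Clusters.
Variables (V : finType) (E1 E2 : {set {set V}}) (k : nat).
Local Notation E := (edge E1 E2).
Local Notation col := {ffun E -> 'I_k}.
Implicit Types (X Y Z : col) (e f i u v : E) (a b c : 'I_k).

(** * Two-coloured clusters of possibly improper maps *)

Lemma swap_colorC a c x : swap_color a c x = swap_color c a x.
Proof.
rewrite /swap_color; case: (eqVneq x a) => [->|_]; case: ifP => // /eqP.
by move->.
Qed.

Lemma swap_color_l a c : swap_color a c a = c.
Proof. by rewrite /swap_color eqxx. Qed.

Lemma swap_color_r a c : swap_color a c c = a.
Proof. by rewrite swap_colorC swap_color_l. Qed.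

Lemma swap_color_id a x : swap_color a a x = x.
Proof. by rewrite /swap_color; case: (eqVneq x a). Qed.

Lemma alternatesC X a c : alternates X a c =2 alternates X c a.
Proof. by move=> f g; rewrite /alternates orbC. Qed.

Lemma alternates_sym X a c : symmetric (alternates X a c).
Proof.
move=> f g; rewrite /alternates hat_adjC; congr (_ && _).
by rewrite orbC andbC [in RHS]orbC [X in _ || X]andbC orbC.
Qed.

Lemma alternates_connect_sym X a c : connect_sym (alternates X a c).
Proof. exact/sym_connect_sym/alternates_sym. Qed.

Lemma flip_clusterE X e c : c != X e ->
  flip_cluster X e c = [set f | connect (alternates X (X e) c) e f].
Proof. by rewrite /flip_cluster => /negbTE ->. Qed.

Lemma flip_cluster_id X e : flip_cluster X e (X e) = [set e].
Proof. by rewrite /flip_cluster eqxx. Qed.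

Lemma mem_flip_cluster X e c : e \in flip_cluster X e c.
Proof. by rewrite /flip_cluster; case: ifP; rewrite inE // connect0. Qed.

Lemma flip_cluster_color X e c f :
  f \in flip_cluster X e c -> (X f == X e) || (X f == c).
Proof.
rewrite /flip_cluster; case: ifP => _; rewrite inE; first by move/eqP->; rewrite eqxx.
case/connectP=> p; elim/last_ind: p => [_ ->|p x _]; first by rewrite eqxx.
rewrite rcons_path last_rcons => /andP[_ /andP[_ /orP[]]] /andP[_ hx] ->;
  by rewrite hx ?orbT.
Qed.

(** A cluster is a component of a symmetric relation, so it may be grown from any of its edges; the
    [swap_color] term is the colour of the pair that [f] does not have. *)
Lemma flip_cluster_eq X e c f : f \in flip_cluster X e c ->
  flip_cluster X f (swap_color (X e) c (X f)) = flip_cluster X e c.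
Proof.
case: (eqVneq c (X e)) => [->|nce] fC.
  by move: fC; rewrite flip_cluster_id inE => /eqP ->; rewrite swap_color_l flip_cluster_id.
have col_f := flip_cluster_color fC; move: fC.
rewrite (flip_clusterE nce) inE => cef.
case/orP: col_f => /eqP Xf; rewrite Xf.
  rewrite swap_color_l flip_clusterE Xf //; apply/setP => g; rewrite !inE.
  by rewrite (same_connect (@alternates_connect_sym X (X e) c) cef).
rewrite swap_color_r flip_clusterE Xf 1?eq_sym //; apply/setP => g; rewrite !inE.
rewrite (eq_connect (alternatesC X c (X e))).
by rewrite (same_connect (@alternates_connect_sym X (X e) c) cef).
Qed.

Lemma swap_color_cluster X e c f : f \in flip_cluster X e c ->
  swap_color (X f) (swap_color (X e) c (X f)) =1 swap_color (X e) c.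
Proof.
move=> /flip_cluster_color /orP[] /eqP -> x; first by rewrite swap_color_l.
by rewrite swap_color_r swap_colorC.
Qed.

Lemma flip_fun_eq X e c f : f \in flip_cluster X e c ->
  flip_fun X f (swap_color (X e) c (X f)) = flip_fun X e c.
Proof.
by move=> fC; apply/ffunP => g; rewrite !ffunE (flip_cluster_eq fC) swap_color_cluster.
Qed.

Lemma flip_cluster_sym X e c f : f \in flip_cluster X e c ->
  e \in flip_cluster X f (swap_color (X e) c (X f)).
Proof. by move=> fC; rewrite (flip_cluster_eq fC) mem_flip_cluster. Qed.

Lemma swap_color_clusterK X e c f : f \in flip_cluster X e c ->
  swap_color (X f) (swap_color (X e) c (X f)) (X e) = c.
Proof. by move=> fC; rewrite (swap_color_cluster fC) swap_color_l. Qed.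

Lemma flip_fun_id X e : flip_fun X e (X e) = X.
Proof. by apply/ffunP => f; rewrite ffunE swap_color_id if_same. Qed.

(** Moves whose cluster contains [v] are listed by the colour that [v] receives, then by the edge
    through which the cluster is picked. *)
Lemma sum_cluster_reindex (R : nmodType) X v (G : E -> 'I_k -> R) :
  \sum_e \sum_(c | v \in flip_cluster X e c) G e c =
  \sum_c \sum_(e in flip_cluster X v c) G e (swap_color (X v) c (X e)).
Proof.
rewrite [RHS](exchange_big_dep predT) //=; apply: eq_bigr => e _.
rewrite (reindex_onto (fun c => swap_color (X v) c (X e))
                      (fun c => swap_color (X e) c (X v))) /=; last first.
  by move=> c vC; rewrite swap_color_clusterK.
apply: eq_bigl => c; apply/andP/idP => [[vC /eqP <-]|eC].
  exact: flip_cluster_sym.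
by rewrite flip_cluster_sym // swap_color_clusterK.
Qed.

Lemma alternates_agree X Y v a c f g : {in predC1 v, X =1 Y} ->
  f != v -> g != v -> alternates X a c f g = alternates Y a c f g.
Proof. by move=> XY fv gv; rewrite /alternates !XY. Qed.

Lemma flip_cluster_agree_sub X Y v e c : {in predC1 v, X =1 Y} ->
  v \notin flip_cluster X e c -> flip_cluster X e c \subset flip_cluster Y e c.
Proof.
move=> XY nv; have ev : e != v.
  by apply: contraNneq nv => <-; apply: mem_flip_cluster.
case: (eqVneq c (X e)) => [->|nce].
  by rewrite flip_cluster_id sub1set mem_flip_cluster.
have nceY : c != Y e by rewrite -XY.
apply/subsetP => f; move: nv; rewrite (flip_clusterE nce) (flip_clusterE nceY) !inE.
move=> nv /connectP[p pth ->] {f}; elim/last_ind: p pth => [|p x IH]; first by rewrite /= connect0.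
rewrite rcons_path last_rcons => /andP[pth alt].
apply: connect_trans (IH pth) (connect1 _).
have conn: connect (alternates X (X e) c) e (last e p) by apply/connectP; exists p.
rewrite -XY // -(@alternates_agree X Y v) //.
  by apply: contraNneq nv => <-.
by apply: contraNneq nv => <-; apply: connect_trans conn (connect1 alt).
Qed.

Lemma flip_cluster_agree X Y v e c : {in predC1 v, X =1 Y} ->
  v \notin flip_cluster X e c -> v \notin flip_cluster Y e c ->
  flip_cluster X e c = flip_cluster Y e c.
Proof.
move=> XY nvX nvY; apply/eqP; rewrite eqEsubset (flip_cluster_agree_sub XY) //=.
by apply: (flip_cluster_agree_sub (v := v)) => // u uv; rewrite XY.
Qed.

Lemma adj_flip_cluster X v i c : hat_adj v i -> X i = c -> c != X v ->
  i \in flip_cluster X v c.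
Proof.
move=> adj Xi nc; rewrite flip_clusterE // inE connect1 //.
by rewrite /alternates adj Xi !eqxx.
Qed.

(* Removing [v] from its cluster leaves the [Y]-clusters of those neighbours of *)
(* [v] that are coloured [c]; these may overlap or, when [c = Y v], regain [v]. *)
Lemma flip_cluster_cover X Y v c e : {in predC1 v, X =1 Y} -> c != X v ->
  e \in flip_cluster X v c -> e != v ->
  exists i, [/\ hat_adj v i, X i = c & e \in flip_cluster Y i (X v)].
Proof.
move=> XY nc; rewrite flip_clusterE // inE => /connectP[p pth ->] {e}.
case/shortenP: pth => -[|i q]; first by rewrite /= eqxx.
rewrite [path _ _ _]/= => /andP[alt pth] /= /andP[vnot _] _ _.
have Xi : X i = c.
  by case/andP: alt => _ /orP[/andP[_ /eqP //]|/andP[/eqP Xv]]; rewrite Xv eqxx in nc.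
have iv : i != v by move: vnot; rewrite inE negb_or eq_sym => /andP[].
exists i; split => //; first by case/andP: alt.
rewrite flip_clusterE -XY ?Xi // 1?eq_sym // inE.
apply/connectP; exists q => //.
move: vnot; rewrite inE negb_or => /andP[_ vq].
elim: q i {alt Xi} iv vq pth => //= j q IH i iv; rewrite inE negb_or => /andP[vj vq] /andP[alt pth].
have jv : j != v by rewrite eq_sym.
by rewrite IH // andbT alternatesC -(@alternates_agree X Y v).
Qed.

Lemma flip_cluster_coverE X Y v c e i : {in predC1 v, X =1 Y} -> i != v ->
  X i = c -> e \in flip_cluster Y i (X v) -> e != v ->
  flip_cluster Y e (swap_color (X v) c (X e)) = flip_cluster Y i (X v) /\
  flip_fun Y e (swap_color (X v) c (X e)) = flip_fun Y i (X v).
Proof.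
move=> XY iv Xi eC ev; rewrite (XY e) // swap_colorC -Xi (XY i) //.
by rewrite flip_cluster_eq // flip_fun_eq.
Qed.

(** The cluster uses only the colours [c] and [X v], and [Y v] is neither. *)
Lemma notin_flip_cluster X Y v c i : {in predC1 v, X =1 Y} -> X v != Y v ->
  c != Y v -> i != v -> X i = c -> v \notin flip_cluster Y i (X v).
Proof.
move=> XY nXY ncY iv Xi; apply/negP => /flip_cluster_color.
by rewrite -(XY i) // Xi eq_sym (negbTE ncY) eq_sym (negbTE nXY).
Qed.

Lemma flip_cluster_sub X Y v c i : {in predC1 v, X =1 Y} -> c != X v ->
  hat_adj v i -> X i = c -> v \notin flip_cluster Y i (X v) ->
  flip_cluster Y i (X v) \subset flip_cluster X v c.
Proof.
move=> XY nc adj Xi nv.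
have iC := adj_flip_cluster adj Xi nc.
rewrite -(flip_cluster_eq iC) Xi swap_color_r.
by apply: (flip_cluster_agree_sub (v := v)) => // u uv; rewrite XY.
Qed.

Lemma hat_adj_neq v i : hat_adj v i -> i != v.
Proof. by case/and3P; rewrite eq_sym. Qed.

Lemma flip_cluster_isolated X v c : c != X v ->
  (forall i, hat_adj v i -> X i != c) -> flip_cluster X v c = [set v].
Proof.
move=> nc iso; apply/setP => e; rewrite inE; case: (eqVneq e v) => [->|ev].
  exact: mem_flip_cluster.
apply/negbTE/negP => eC; have [|i [adj Xi _]] := flip_cluster_cover (Y := X) _ nc eC ev.
  by [].
by move: (iso i adj); rewrite Xi eqxx.
Qed.

Lemma flip_cluster_single X Y v c i : {in predC1 v, X =1 Y} -> c != X v ->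
  hat_adj v i -> X i = c -> (forall j, hat_adj v j -> X j = c -> j = i) ->
  v \notin flip_cluster Y i (X v) ->
  flip_cluster X v c = v |: flip_cluster Y i (X v).
Proof.
move=> XY nc adj Xi uni nv; apply/eqP; rewrite eqEsubset; apply/andP; split.
  apply/subsetP => e eC; rewrite in_setU1; case: (eqVneq e v) => //= ev.
  by have [j [aj Xj ej]] := flip_cluster_cover XY nc eC ev; rewrite -(uni j).
by rewrite subUset sub1set mem_flip_cluster (flip_cluster_sub XY).
Qed.

Lemma flip_cluster_card_ge X v c : c != X v ->
  (#|[set i | hat_adj v i & X i == c]| < #|flip_cluster X v c|)%N.
Proof.
move=> nc; have -> : #|[set i | hat_adj v i & X i == c]|.+1 =
    #|v |: [set i | hat_adj v i & X i == c]|.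
  by rewrite cardsU1 inE /hat_adj eqxx.
apply/subset_leq_card/subsetP => e; rewrite in_setU1 => /orP[/eqP ->|].
  exact: mem_flip_cluster.
by rewrite inE => /andP[adj /eqP Xe]; apply: adj_flip_cluster.
Qed.

End Clusters.

Lemma ler_sum_cover (R : numDomainType) (I J : finType) (P : pred I) (D : {pred J})
    (Q : J -> pred I) (G : I -> R) :
  (forall e, 0 <= G e) -> (forall e, P e -> exists2 i, i \in D & Q i e) ->
  \sum_(e | P e) G e <= \sum_(i in D) \sum_(e | Q i e) G e.
Proof.
move=> G0 cov; rewrite (exchange_big_dep predT) //= [leLHS]big_mkcond /=.
apply: ler_sum => e _; case: ifP => [/cov[i iD Qi]|_]; last by rewrite sumr_ge0.
by rewrite (bigD1 i) /= ?iD // lerDl sumr_ge0.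
Qed.

(** * Decomposition of the drift, and bounds for a single pair of maps *)

Section Drift.
Variables (R : realType) (V : finType) (E1 E2 : {set {set V}}) (k : nat).
Local Notation E := (edge E1 E2).
Local Notation col := {ffun E -> 'I_k}.
Variables (p : nat -> R) (wt : E -> R).
Implicit Types (X Y Z : col) (e i u v : E) (c : 'I_k) (f : col -> R) (S T : {set E}).

Definition cweight (S : {set E}) : R := \sum_(u in S) wt u.

Definition cdist X Y : R := \sum_(u | X u != Y u) wt u.

Definition lipschitz f : Prop := forall X Y, f X - f Y <= cdist X Y.

Definition flip_rate X e c : R :=
  p #|flip_cluster X e c| / #|flip_cluster X e c|%:R.

Definition flip_drift f X : R :=
  \sum_e \sum_c flip_rate X e c * (f (flip_fun X e c) - f X).

(* The moves of [X] whose cluster contains [v] and that recolour [v] with [c], *)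
(* against the moves of [Y] on the same edges whose cluster avoids [v].        *)
Definition half_drift f X Y v c : R :=
  p #|flip_cluster X v c| * (f (flip_fun X v c) - f X) -
  \sum_(e in flip_cluster X v c |
        v \notin flip_cluster Y e (swap_color (X v) c (X e)))
    flip_rate Y e (swap_color (X v) c (X e)) *
      (f (flip_fun Y e (swap_color (X v) c (X e))) - f Y).

Lemma card_flip_cluster_gt0 X e c : (0 < #|flip_cluster X e c|)%N.
Proof. by apply/card_gt0P; exists e; apply: mem_flip_cluster. Qed.

(** The division by the size in the rate is undone here: a cluster of s edges can be picked through
    each of them, so it flips at total rate [p s]. *)
Lemma sum_flip_rate X e c (x : R) :
  \sum_(u in flip_cluster X e c)
    p #|flip_cluster X e c| / #|flip_cluster X e c|%:R * x =
  p #|flip_cluster X e c| * x.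
Proof.
rewrite sumr_const -[LHS]mulr_natr.
have : #|flip_cluster X e c|%:R != 0 :> R by rewrite pnatr_eq0 -lt0n card_flip_cluster_gt0.
by move: (p _) (#|_|%:R) => q n n0; field.
Qed.

Lemma drift_split_one f X Y v :
  flip_drift f X =
    \sum_c p #|flip_cluster X v c| * (f (flip_fun X v c) - f X) +
    \sum_c \sum_(e in flip_cluster Y v c |
                 v \notin flip_cluster X e (swap_color (Y v) c (Y e)))
      flip_rate X e (swap_color (Y v) c (Y e)) *
        (f (flip_fun X e (swap_color (Y v) c (Y e))) - f X) +
    \sum_e \sum_(c | (v \notin flip_cluster X e c) && (v \notin flip_cluster Y e c))
      flip_rate X e c * (f (flip_fun X e c) - f X).
Proof.
pose G e c := flip_rate X e c * (f (flip_fun X e c) - f X).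
rewrite /flip_drift.
have -> : \sum_e \sum_c G e c =
   \sum_e \sum_(c | v \in flip_cluster X e c) G e c +
   \sum_e \sum_(c | (v \in flip_cluster Y e c) && (v \notin flip_cluster X e c)) G e c +
   \sum_e \sum_(c | (v \notin flip_cluster X e c) && (v \notin flip_cluster Y e c)) G e c.
  rewrite -!big_split /=; apply: eq_bigr => e _.
  rewrite (bigID (fun c => v \in flip_cluster X e c)) /= -addrA; congr (_ + _).
  rewrite (bigID (fun c => v \in flip_cluster Y e c)) /=; congr (_ + _).
  by apply: eq_bigl => c; rewrite andbC.
congr (_ + _ + _).
  rewrite sum_cluster_reindex; apply: eq_bigr => c _.
  rewrite -sum_flip_rate; apply: eq_bigr => e eC.
  by rewrite /G /flip_rate flip_cluster_eq // flip_fun_eq.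
under eq_bigr do rewrite big_mkcondr.
rewrite (sum_cluster_reindex Y v
  (fun e c => if v \notin flip_cluster X e c then G e c else 0)).
by apply: eq_bigr => c _; rewrite -big_mkcondr.
Qed.

(** Clusters avoiding [v] in both maps coincide and have equal rates, so these moves are coupled
    identically. Replacing [f] by its negative and exchanging the maps turns the moves of [Y] at [v]
    into a second [half_drift]. *)
Lemma drift_split f X Y v : {in predC1 v, X =1 Y} ->
  flip_drift f X - flip_drift f Y =
  \sum_e \sum_(c | (v \notin flip_cluster X e c) && (v \notin flip_cluster Y e c))
     flip_rate X e c * (f (flip_fun X e c) - f (flip_fun Y e c) - (f X - f Y)) +
  \sum_c (half_drift f X Y v c + half_drift (fun Z => - f Z) Y X v c).
Proof.
move=> XY; rewrite (drift_split_one f X Y v) (drift_split_one f Y X v).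
have -> : \sum_e \sum_(c | (v \notin flip_cluster Y e c) && (v \notin flip_cluster X e c))
      flip_rate Y e c * (f (flip_fun Y e c) - f Y) =
    \sum_e \sum_(c | (v \notin flip_cluster X e c) && (v \notin flip_cluster Y e c))
      flip_rate X e c * (f (flip_fun Y e c) - f Y).
  apply: eq_bigr => e _; apply: eq_big => [c|c /andP[vY vX]]; first by rewrite andbC.
  by rewrite /flip_rate (flip_cluster_agree XY).
set x1 := (X in X + _ + _ - _ = _); set x2 := (X in _ + X + _ - _ = _).
set x3 := (X in _ + _ + X - _ = _); set y1 := (X in _ - (X + _ + _) = _).
set y2 := (X in _ - (_ + X + _) = _); set y3 := (X in _ - (_ + _ + X) = _).
set z3 := (X in _ = X + _); set z := (X in _ = _ + X).
have -> : z3 = x3 - y3.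
  rewrite /z3 /x3 /y3 -sumrB; apply: eq_bigr => e _; rewrite -sumrB.
  by apply: eq_bigr => c _; ring.
suff -> : z = x1 - y2 + (x2 - y1) by ring.
rewrite /z /x1 /y1 /x2 /y2 big_split /= -!sumrB; congr (_ + _).
apply: eq_bigr => c _; rewrite /half_drift addrC; congr (_ + _).
  by rewrite -sumrN; apply: eq_bigr => e _; ring.
ring.
Qed.

Lemma half_drift_id f X Y v : half_drift f X Y v (X v) = 0.
Proof.
rewrite /half_drift flip_fun_id subrr mulr0 flip_cluster_id big1 ?subr0 // => e.
by case/andP => /set1P ->; rewrite mem_flip_cluster.
Qed.

Hypothesis wt_ge0 : forall u, 0 <= wt u.

Lemma cweight_ge0 S : 0 <= cweight S.
Proof. exact: sumr_ge0. Qed.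

Lemma cdistC X Y : cdist X Y = cdist Y X.
Proof. by apply: eq_bigl => u; rewrite eq_sym. Qed.

Lemma cdist_le X Y (S : {set E}) :
  (forall u, u \notin S -> X u = Y u) -> cdist X Y <= cweight S.
Proof.
move=> sub; rewrite /cdist /cweight [leLHS]big_mkcond [leRHS]big_mkcond /=.
apply: ler_sum => u _; case: ifP => [XYu|_]; last by case: ifP.
by case: ifPn => // /sub uS; rewrite uS eqxx in XYu.
Qed.

Lemma lipschitzN f : lipschitz f -> lipschitz (fun Z => - f Z).
Proof. by move=> lf X Y; rewrite opprK addrC cdistC; apply: lf. Qed.

Lemma lipschitz_le f X Y (S : {set E}) : lipschitz f ->
  (forall u, u \notin S -> X u = Y u) -> f X - f Y <= cweight S.
Proof. by move=> lf /cdist_le; apply: le_trans. Qed.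

Lemma flip_fun_out X e c u : u \notin flip_cluster X e c -> flip_fun X e c u = X u.
Proof. by rewrite ffunE => /negbTE ->. Qed.

Lemma lipschitz_flip f X e c : lipschitz f ->
  f (flip_fun X e c) - f X <= cweight (flip_cluster X e c).
Proof. by move=> lf; apply: lipschitz_le => // u; apply: flip_fun_out. Qed.

Lemma lipschitz_flipN f X e c : lipschitz f ->
  f X - f (flip_fun X e c) <= cweight (flip_cluster X e c).
Proof. by move=> lf; apply: lipschitz_le => // u; rewrite ffunE => /negbTE ->. Qed.

Lemma cweight1 v : cweight [set v] = wt v.
Proof. exact: big_set1. Qed.

Lemma cweightU1 v S : cweight (v |: S) <= wt v + cweight S.
Proof.
rewrite /cweight; case: (boolP (v \in S)) => vS; last by rewrite big_setU1.
by have /setUidPr -> : [set v] \subset S; rewrite ?sub1set // lerDr.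
Qed.

(** Two clusters flipped together pay only once for a common edge; this saving makes the coupling at
    a colour seen once profitable. *)
Lemma cweightU i S T : i \in S -> i \in T ->
  cweight (S :|: T) <= cweight S + cweight T - wt i.
Proof.
move=> iS iT; rewrite lerBrDr /cweight [\sum_(u in S :|: T) _]big_mkcond.
rewrite [\sum_(u in S) _]big_mkcond [\sum_(u in T) _]big_mkcond /= -big_split /=.
rewrite (bigD1 i) //= [leRHS](bigD1 i) //= in_setU iS iT /= [leLHS]addrAC lerD2l.
apply: ler_sum => u _; rewrite in_setU; case: (u \in S); case: (u \in T) => //=;
  by rewrite ?addr0 ?add0r // lerDl.
Qed.

Hypothesis wt_le1 : forall u, wt u <= 1.

Lemma cweight_mem i S : i \in S -> cweight S <= wt i + (#|S|%:R - 1).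
Proof.
move=> iS; rewrite /cweight (bigD1 i) //= lerD2l (cardD1 i) iS /= natrD addrAC subrr add0r.
rewrite -sum1_card natr_sum; apply: le_trans (_ : \sum_(u in S | u != i) 1 <= _).
  exact: ler_sum.
by rewrite le_eqVlt; apply/orP; left; apply/eqP; apply: eq_bigl => u; rewrite inE andbC.
Qed.

Lemma cweight_card S : cweight S <= #|S|%:R.
Proof.
rewrite /cweight -sum1_card natr_sum; exact: ler_sum.
Qed.

Lemma cweight_card1 i S : i \in S -> #|S| = 1%N -> cweight S = wt i.
Proof. by move=> iS /eqP/cards1P[j eS]; move: iS; rewrite eS cweight1 => /set1P ->. Qed.

(** Here [r] bounds the excess loss (b - 1) q_b, [mu] bounds the expected weight of a flip of two or
    more edges, and [rho] bounds what a flip of three or more edges can change besides [v]. The last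
    two conditions let an edge weight absorb these losses. *)
Variables (r mu rho : R).
Hypotheses (p1 : p 1%N = 1) (p_ge0 : forall a, 0 <= p a)
  (p_half : forall a, (2 <= a)%N -> p a <= 2^-1)
  (p_noninc : forall a, (1 <= a)%N -> p a.+1 <= p a)
  (r_ge0 : 0 <= r) (mu_ge0 : 0 <= mu) (rho_ge0 : 0 <= rho)
  (p_r : forall a, (1 <= a)%N -> (a%:R - 1) * (p a - p a.+1) <= r)
  (p_mu : forall a, (2 <= a)%N -> a%:R * p a <= mu)
  (p_rho : forall a, (3 <= a)%N -> (a%:R - 1) * p a <= rho)
  (mu_wt : forall u, 2 * mu <= wt u * (1 - p 2))
  (r_wt : forall u, r * (1 + wt u) <= wt u * (1 - p 2)).

Lemma p_le1 a : (1 <= a)%N -> p a <= 1.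
Proof.
case: a => [|[|a]] // _; first by rewrite p1.
by apply: le_trans (p_half _) _ => //; lra.
Qed.

Lemma mu_le_wt u : mu <= wt u.
Proof.
apply: (@le_trans _ _ (2 * mu)); first by rewrite ler_peMl // ler1n.
apply: le_trans (mu_wt u) _; rewrite ler_piMr //.
by have := p_ge0 2; lra.
Qed.

Lemma flip_rate_ge0 X e c : 0 <= flip_rate X e c.
Proof. by rewrite divr_ge0. Qed.

Lemma flip_rate_le1 X e c : flip_rate X e c <= 1.
Proof.
have C0 := card_flip_cluster_gt0 X e c.
rewrite /flip_rate ler_pdivrMr ?ltr0n // mul1r.
by apply: le_trans (p_le1 C0) _; rewrite ler1n.
Qed.

Lemma p_cweight_le S : (2 <= #|S|)%N -> p #|S| * cweight S <= mu.
Proof.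
move=> S2; apply: le_trans (p_mu S2); rewrite mulrC.
exact: ler_wpM2r (cweight_card S).
Qed.

Section Pair.
Variables (f : col -> R) (X Y : col) (v : E).
Hypotheses (lf : lipschitz f) (XY : {in predC1 v, X =1 Y}).
Local Notation W := (wt v).
Local Notation F := (f X - f Y).

(** The cluster of [v] in [X] is that of [i] in [Y] with [v] added. Flip both with the smaller
    probability, after which the maps differ at most at [v]; the excess is a flip in [Y] alone. *)
Lemma half_drift_single c i : c != X v -> hat_adj v i -> X i = c ->
    (forall j, hat_adj v j -> X j = c -> j = i) ->
    v \notin flip_cluster Y i (X v) ->
  half_drift f X Y v c <=
    p #|flip_cluster Y i (X v)|.+1 * (W - F) +
    (p #|flip_cluster Y i (X v)| - p #|flip_cluster Y i (X v)|.+1) *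
      (f Y - f (flip_fun Y i (X v))).
Proof.
move=> nc adj Xi uni nv; have iv := hat_adj_neq adj.
have CXE := flip_cluster_single XY nc adj Xi uni nv.
set C := flip_cluster Y i (X v) in nv CXE *.
have cardX : #|flip_cluster X v c| = #|C|.+1 by rewrite CXE cardsU1 nv.
rewrite /half_drift cardX.
have -> : \sum_(e in flip_cluster X v c |
        v \notin flip_cluster Y e (swap_color (X v) c (X e)))
    flip_rate Y e (swap_color (X v) c (X e)) *
      (f (flip_fun Y e (swap_color (X v) c (X e))) - f Y) =
    p #|C| * (f (flip_fun Y i (X v)) - f Y).
  rewrite -sum_flip_rate.
  have eqC e : e \in C -> e != v by apply: contraTneq => ->.
  apply: eq_big => [e|e].
    rewrite CXE in_setU1; case: (eqVneq e v) => [->|ev] /=.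
      by rewrite mem_flip_cluster (negbTE nv).
    case: (boolP (e \in C)) => //= eC.
    by have [-> _] := flip_cluster_coverE XY iv Xi eC ev.
  rewrite CXE in_setU1 => /andP[/orP[/eqP->|eC]]; first by rewrite mem_flip_cluster.
  by move=> _; rewrite /flip_rate; have [-> ->] := flip_cluster_coverE XY iv Xi eC (eqC e eC).
have le1 : f (flip_fun X v c) - f (flip_fun Y i (X v)) <= W.
  rewrite -cweight1; apply: lipschitz_le => // u; rewrite inE => uv.
  rewrite !ffunE CXE in_setU1 (negbTE uv) /= -/C (XY uv) -(XY iv) Xi.
  by rewrite swap_colorC.
have := ler_wpM2l (p_ge0 #|C|.+1) le1.
lra.
Qed.

(** The clusters of the neighbours coloured [c] cover the relevant moves of [Y]. Those with several
    edges are bounded by [mu] each; single-edge clusters keep their exact term, to be coupled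
    later. *)
Lemma half_drift_cover c : c != X v ->
  half_drift f X Y v c <=
    p #|flip_cluster X v c| * (f (flip_fun X v c) - f X) +
    \sum_(i in [set i | hat_adj v i & X i == c])
      (if #|flip_cluster Y i (X v)| == 1%N then f Y - f (flip_fun Y i (X v)) else mu).
Proof.
move=> nc; rewrite /half_drift lerD2l.
pose sw e := swap_color (X v) c (X e); rewrite -/(sw _).
pose P e := (e \in flip_cluster X v c) && (v \notin flip_cluster Y e (sw e)).
rewrite -sumrN.
pose D := [set i | hat_adj v i & X i == c]; rewrite -/D.
have cov e : P e -> exists i, [/\ i \in D, e \in flip_cluster Y i (X v),
    flip_cluster Y e (sw e) = flip_cluster Y i (X v) &
    flip_fun Y e (sw e) = flip_fun Y i (X v)].
  case/andP => eC nv.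
  have ev : e != v by apply: contraNneq nv => ->; apply: mem_flip_cluster.
  have [i [adj Xi eCi]] := flip_cluster_cover XY nc eC ev.
  have [h1 h2] := flip_cluster_coverE XY (hat_adj_neq adj) Xi eCi ev.
  by exists i; split=> //; rewrite inE adj Xi eqxx.
rewrite (bigID (fun e => #|flip_cluster Y e (sw e)| == 1%N)) /=.
rewrite [leRHS](bigID (fun i => #|flip_cluster Y i (X v)| == 1%N)) /=.
apply: lerD.
  (* Single-edge clusters must match exactly: their terms have no definite sign, so a covering bound
     would not do. *)
  have swD i : i \in D -> sw i = X v.
    by rewrite inE => /andP[_ /eqP Xi]; rewrite /sw Xi swap_color_r.
  have single e : P e -> #|flip_cluster Y e (sw e)| == 1%N -> e \in D.
    move=> Pe card1; have [i [iD eC eqC _]] := cov e Pe.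
    have ii : i \in flip_cluster Y e (sw e) by rewrite eqC mem_flip_cluster.
    suff -> : e = i by [].
    move/cards1P: card1 => [j ej]; move: ii (mem_flip_cluster Y e (sw e)).
    by rewrite ej => /set1P -> /set1P ->.
  rewrite le_eqVlt; apply/orP; left; apply/eqP; apply: eq_big => [e|e].
    apply/andP/andP => -[].
      by move=> Pe card1; have eD := single e Pe card1; rewrite -(swD e).
    move=> eD card1; rewrite -/(P e) /P (swD e eD); split => //.
    move: (eD); rewrite inE => /andP[adj /eqP Xe].
    rewrite adj_flip_cluster //=.
    move/cards1P: card1 => [j ej]; move: (mem_flip_cluster Y e (X v)).
    by rewrite ej => /set1P <-; rewrite inE eq_sym hat_adj_neq.
  case/andP => Pe card1; have /swD swe := single e Pe card1.
  by rewrite -/(sw e) -swe card1 /flip_rate (eqP card1) p1 divr1 mul1r opprB.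
pose G e := flip_rate Y e (sw e) * cweight (flip_cluster Y e (sw e)).
apply: (@le_trans _ _ (\sum_(e | P e && (#|flip_cluster Y e (sw e)| != 1%N)) G e)).
  apply: ler_sum => e _; rewrite -mulrN opprB.
  by apply: ler_wpM2l; [apply: flip_rate_ge0 | apply: lipschitz_flipN].
pose D' := [set i in D | #|flip_cluster Y i (X v)| != 1%N].
apply: (@le_trans _ _ (\sum_(i in D') \sum_(e | P e && (e \in flip_cluster Y i (X v))) G e)).
  apply: ler_sum_cover => [e|e /andP[Pe card1]].
    by apply: mulr_ge0; [apply: flip_rate_ge0 | apply: cweight_ge0].
  have [i [iD eC eqC eqF]] := cov e Pe.
  by exists i; rewrite ?Pe // inE iD -eqC.
have -> : \sum_(i in D | #|flip_cluster Y i (X v)| != 1%N)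
   (if #|flip_cluster Y i (X v)| == 1%N then f Y - f (flip_fun Y i (X v)) else mu) =
   \sum_(i in D') mu.
  by apply: eq_big => [i|i /andP[_ /negbTE ->]]; rewrite ?inE.
apply: ler_sum => i; rewrite !inE => /andP[/andP[adj /eqP Xi] card1].
set C := flip_cluster Y i (X v) in card1 *.
apply: (@le_trans _ _ (\sum_(e in C) p #|C| / #|C|%:R * cweight C)).
  rewrite [leLHS]big_mkcond [leRHS]big_mkcond; apply: ler_sum => e _ /=.
  have pos : 0 <= p #|C| / #|C|%:R * cweight C.
    by rewrite mulr_ge0 ?divr_ge0 // cweight_ge0.
  case: ifP => [/andP[/andP[eX nv] eC]|_]; last by case: ifP.
  have ev : e != v by apply: contraNneq nv => ->; apply: mem_flip_cluster.
  rewrite eC /G /flip_rate /sw.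
  by have [-> _] := flip_cluster_coverE XY (hat_adj_neq adj) Xi eC ev.
rewrite sum_flip_rate; apply: p_cweight_le.
by rewrite ltn_neqAle eq_sym card1 /C card_flip_cluster_gt0.
Qed.


Lemma lipschitz_pair : F <= W.
Proof.
rewrite -cweight1; apply: lipschitz_le => // u; rewrite inE => uv.
exact: XY.
Qed.

Lemma p_flip_le_mu c : (2 <= #|flip_cluster X v c|)%N ->
  p #|flip_cluster X v c| * (f (flip_fun X v c) - f X) <= mu.
Proof.
move=> C2; apply: le_trans (p_cweight_le C2).
by rewrite ler_wpM2l // lipschitz_flip.
Qed.

(** Compared with [Y] rather than [X], the flipped map costs [W] for [v] itself, and only the other
    edges of the cluster are a loss. *)
Lemma p_flip_le_rho c : (3 <= #|flip_cluster X v c|)%N ->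
  p #|flip_cluster X v c| * (f (flip_fun X v c) - f X) <=
  p #|flip_cluster X v c| * (W - F) + rho.
Proof.
move=> C3; set C := flip_cluster X v c in C3 *.
have vC : v \in C by apply: mem_flip_cluster.
have le1 : f (flip_fun X v c) - f Y <= W + (#|C|%:R - 1).
  apply: le_trans (cweight_mem vC); apply: lipschitz_le => // u uC.
  rewrite flip_fun_out // XY //; apply: contraNneq uC => ->.
  exact: vC.
have := ler_wpM2l (p_ge0 #|C|) le1; have := p_rho C3.
by lra.
Qed.

End Pair.

(** Equality at [a = 1]; beyond that the factor a - 1 is at least 1, so [r] bounds the difference,
    and the weight condition at [u] gives r <= 1 - p_2. *)
Lemma q_le u a : (1 <= a)%N -> p a - p a.+1 <= 1 - p 2.
Proof.
have r_le : r <= 1 - p 2.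
  have := r_wt u; have := wt_le1 u; have := wt_ge0 u => w0 w1 le_r.
  apply: (@le_trans _ _ (r * (1 + wt u))); first by rewrite ler_peMr // lerDl.
  by apply: le_trans le_r _; rewrite ler_piMl // subr_ge0 p_le1.
case: a => [|[|a]] // _; first by rewrite p1.
apply: le_trans r_le; apply: le_trans (p_r (a := a.+2) _) => //.
rewrite ler_peMl ?subr_ge0 ?p_noninc // lerBrDr -[1 + 1]/(2%:R) ler_nat //.
Qed.

(** * Drift per colour, charged to the neighbours of that colour *)

Section Budget.
Variables (v : E) (beta : E -> R).
Hypotheses
  (beta1 : forall i, hat_adj v i -> wt v + wt i * (1 - p 2) + r <= beta i)
  (beta2 : forall i, hat_adj v i -> wt v / 2 + rho + wt i + mu <= beta i).
Local Notation W := (wt v).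

(** With at least two neighbours, their shares W / 2 and [rho] already pay for one W and for a large
    flip in each map. *)
Lemma sum_beta_ge (D : {set E}) : (forall i, i \in D -> hat_adj v i) -> (2 <= #|D|)%N ->
  W + 2 * rho + \sum_(i in D) (wt i + mu) <= \sum_(i in D) beta i.
Proof.
move=> adj D2; apply: (@le_trans _ _ (\sum_(i in D) (wt v / 2 + rho + (wt i + mu)))).
  rewrite [leRHS]big_split /= lerD2r sumr_const -mulr_natl.
  have x0 : 0 <= W / 2 + rho by rewrite addr_ge0 ?divr_ge0.
  have : 2%:R <= #|D|%:R :> R by rewrite ler_nat.
  by move=> /(ler_wpM2r x0); lra.
by apply: ler_sum => i /adj /beta2; rewrite addrA.
Qed.

(** If no neighbour has colour [Y v], the flip turns [X] into [Y], which gains F in full. The other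
    cases arise only when [Y] is improper, and crude bounds suffice. *)
Lemma half_drift_other f X Y : lipschitz f -> {in predC1 v, X =1 Y} -> X v != Y v ->
  half_drift f X Y v (Y v) <=
    (W - (f X - f Y)) + \sum_(i in [set i | hat_adj v i & X i == Y v]) beta i - W.
Proof.
move=> lf XY nXY; have nc : Y v != X v by rewrite eq_sym.
have FW := lipschitz_pair lf XY.
have cov := half_drift_cover lf XY nc.
set D := [set i | _ & _] in cov *.
have adjD i : i \in D -> hat_adj v i by rewrite inE => /andP[].
case: (posnP #|D|) => [D0|]; last rewrite leq_eqVlt => /orP[/eqP D1|D2].
- have De : D = set0 by apply/eqP; rewrite -cards_eq0 D0.
  have CX : flip_cluster X v (Y v) = [set v].
    apply: flip_cluster_isolated => // i adj; apply/negP => Xi.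
    by have := in_set0 i; rewrite -De inE adj Xi.
  apply: le_trans cov _; rewrite De !big_set0 CX cards1 p1.
  have -> : flip_fun X v (Y v) = Y.
    apply/ffunP => u; rewrite ffunE CX inE; case: (eqVneq u v) => [->|uv].
      by rewrite swap_color_l.
    exact: XY.
  by lra.
- have /eqP/cards1P[i Di] := esym D1.
  have : i \in D by rewrite Di set11.
  rewrite inE => /andP[adj /eqP Xi].
  have uni j : hat_adj v j -> X j = Y v -> j = i.
    by move=> aj Xj; apply/set1P; rewrite -Di inE aj Xj eqxx.
  have b1 := beta1 adj; rewrite Di big_set1.
  set C := flip_cluster Y i (X v).
  have iC : i \in C by apply: mem_flip_cluster.
  case: (boolP (v \in C)) => vC; last first.
    apply: le_trans (half_drift_single lf XY nc adj Xi uni vC) _; rewrite -/C.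
    have a1 : (1 <= #|C|)%N by apply: card_flip_cluster_gt0.
    have q0 : 0 <= p #|C| - p #|C|.+1 by rewrite subr_ge0 p_noninc.
    have le1 : p #|C|.+1 * (W - (f X - f Y)) <= W - (f X - f Y).
      by rewrite ler_piMl ?p_le1 // subr_ge0.
    have le2 : f Y - f (flip_fun Y i (X v)) <= wt i + (#|C|%:R - 1).
      by apply: le_trans (cweight_mem iC); apply: lipschitz_flipN.
    have le3 := ler_wpM2l q0 le2.
    have le4 := ler_wpM2r (wt_ge0 i) (q_le v a1).
    have le5 := p_r a1.
    by lra.
  (* The cluster of [i] regains [v], so both moves have at least two edges and cost 2 [mu] in all,
     covered by [mu_wt]. *)
  apply: le_trans cov _; rewrite Di big_set1 -/C.
  have C2 : (2 <= #|C|)%N.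
    rewrite (cardsD1 v) vC (cardsD1 i) !inE iC (hat_adj_neq adj) //.
  have -> : #|C| == 1%N = false by rewrite gtn_eqF.
  have S2 : (2 <= #|flip_cluster X v (Y v)|)%N.
    by apply: leq_trans (flip_cluster_card_ge nc); rewrite -/D -D1.
  apply: le_trans (lerD (p_flip_le_mu lf S2) (lexx _)) _.
  by have := r_ge0; have := mu_wt i; lra.
- apply: le_trans cov _.
  have S2 : (2 <= #|flip_cluster X v (Y v)|)%N.
    by apply: leq_trans (flip_cluster_card_ge nc); rewrite -/D ltnW.
  have le1 := p_flip_le_mu lf S2.
  have le2 := sum_beta_ge adjD D2.
  have le3 : \sum_(i in D) (if #|flip_cluster Y i (X v)| == 1%N
      then f Y - f (flip_fun Y i (X v)) else mu) <= \sum_(i in D) wt i.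
    apply: ler_sum => i iD; case: ifP => [/eqP c1|_]; last exact: mu_le_wt.
    by rewrite -(cweight_card1 (mem_flip_cluster Y i (X v)) c1) lipschitz_flipN.
  have le4 : mu <= \sum_(i in D) mu.
    have [i iD] : exists i, i \in D by apply/card_gt0P; apply: ltnW.
    by rewrite (bigD1 i) //= lerDl sumr_ge0.
  rewrite big_split /= in le2.
  apply: le_trans (lerD le1 le3) _.
  by have := rho_ge0; have := mu_ge0; lra.
Qed.

(** The excess flips in the two maps, of probabilities [qa] and [qb], are coupled on their common
    mass. There the shared edge of weight [w] counts once, so it is paid with the maximum instead of
    the sum. *)
Lemma pair_mass_le (qa qb x y wc wc' w G : R) :
  0 <= qa <= 1 -> 0 <= qb <= 1 -> 0 <= G ->
  x <= wc -> y <= wc' -> x + y <= G + (wc + wc' - w) ->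
  qa * x + qb * y <= G + Num.max qa qb * w + qa * (wc - w) + qb * (wc' - w).
Proof.
move=> /andP[qa0 qa1] /andP[qb0 qb1] G0 xc yc xy.
case: (leP qa qb) => qab.
  have h1 := ler_wpM2l qa0 xy.
  have h2 : (qb - qa) * y <= (qb - qa) * wc' by rewrite ler_wpM2l // subr_ge0.
  have h3 : qa * G <= G by rewrite ler_piMl.
  by lra.
have h1 := ler_wpM2l qb0 xy.
have h2 : (qa - qb) * x <= (qa - qb) * wc by rewrite ler_wpM2l // subr_ge0 ltW.
have h3 : qb * G <= G by rewrite ler_piMl.
by lra.
Qed.

(** If one cluster has size 1 its factor a - 1 vanishes and a single [r] remains. Otherwise both
    differences are at most [r], and r w + 2 r is absorbed by [r_wt]. *)
Lemma pair_q_le i a b : (1 <= a)%N -> (1 <= b)%N ->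
  Num.max (p a - p a.+1) (p b - p b.+1) * wt i +
    (p a - p a.+1) * (a%:R - 1) + (p b - p b.+1) * (b%:R - 1) <=
  wt i * (1 - p 2) + r.
Proof.
move=> a1 b1.
have q0 d : (1 <= d)%N -> 0 <= p d - p d.+1 by move=> d1; rewrite subr_ge0 p_noninc.
have qr d : (2 <= d)%N -> p d - p d.+1 <= r.
  case: d => [|[|d]] // _; apply: le_trans (p_r (a := d.+2) _) => //.
  by rewrite ler_peMl ?q0 // lerBrDr -[1 + 1]/(2%:R) ler_nat.
have w0 := wt_ge0 i; have rw := r_wt i; have r0 := r_ge0.
have := p_r a1; have := p_r b1.
have M1 : Num.max (p a - p a.+1) (p b - p b.+1) * wt i <= wt i * (1 - p 2).
  by rewrite mulrC ler_wpM2l // ge_max !(q_le i).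
case: (ltngtP a 1%N) a1 => // [a2|a1] _.
  case: (ltngtP b 1%N) b1 => // [b2|b1] _.
    have : Num.max (p a - p a.+1) (p b - p b.+1) * wt i <= r * wt i.
      by rewrite ler_wpM2r // ge_max !qr.
    by lra.
  by move: M1; rewrite b1 subrr; lra.
by move: M1; rewrite a1 subrr; lra.
Qed.

(** No neighbour: both maps move to the same map. One neighbour: the two-level coupling above.
    Several: every cluster at [v] has three or more edges, so [rho] and [mu] suffice. In the last
    two cases the clusters at [v] use at most one slack in total, because [p] is at most 1/2 on
    them. *)
Lemma half_drift_pair f X Y c : lipschitz f -> {in predC1 v, X =1 Y} ->
    X v != Y v -> c != X v -> c != Y v ->
  half_drift f X Y v c + half_drift (fun Z => - f Z) Y X v c <=
    #|flip_cluster X v c|%:R * (W - (f X - f Y)) +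
    \sum_(i in [set i | hat_adj v i & X i == c]) beta i - W.
Proof.
move=> lf XY nXY ncX ncY; have lNf := lipschitzN lf.
have YX : {in predC1 v, Y =1 X} by move=> u uv; rewrite XY.
have nYX : Y v != X v by rewrite eq_sym.
have FW := lipschitz_pair lf XY.
have covX := half_drift_cover lf XY ncX.
have covY := half_drift_cover lNf YX ncY.
have DE : [set i | hat_adj v i & Y i == c] = [set i | hat_adj v i & X i == c].
  apply/setP => i; rewrite !inE; case: (boolP (hat_adj v i)) => //= adj.
  by rewrite XY // inE hat_adj_neq.
have cardX := flip_cluster_card_ge ncX; have cardY := flip_cluster_card_ge ncY.
rewrite DE in covY cardY.
set D := [set i | _ & _] in covX covY cardX cardY *.
have G0 : 0 <= W - (f X - f Y) by rewrite subr_ge0.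
have slots : (#|D|.+1)%:R * (W - (f X - f Y)) <=
    #|flip_cluster X v c|%:R * (W - (f X - f Y)).
  by rewrite ler_wpM2r // ler_nat.
have adjD i : i \in D -> hat_adj v i by rewrite inE => /andP[].
have XD i : i \in D -> X i = c by rewrite inE => /andP[_ /eqP].
have YD i : i \in D -> Y i = c by move=> iD; rewrite -XY ?XD // inE hat_adj_neq ?adjD.
case: (posnP #|D|) => [D0|]; last rewrite leq_eqVlt => /orP[/eqP D1|D2].
- have De : D = set0 by apply/eqP; rewrite -cards_eq0 D0.
  have CX : flip_cluster X v c = [set v].
    apply: flip_cluster_isolated => // i adj; apply/negP => Xi.
    by have := in_set0 i; rewrite -De inE adj Xi.
  have CY : flip_cluster Y v c = [set v].
    apply: flip_cluster_isolated => // i adj; apply/negP => Yi.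
    by have := in_set0 i; rewrite -De /D -DE inE adj Yi.
  move: covX covY slots; rewrite De !big_set0 CX CY !cards1 p1.
  have -> : flip_fun X v c = flip_fun Y v c.
    apply/ffunP => u; rewrite !ffunE CX CY inE; case: (eqVneq u v) => [->|uv].
      by rewrite !swap_color_l.
    exact: XY.
  by lra.
- have /eqP/cards1P[i Di] := esym D1.
  have iD : i \in D by rewrite Di set11.
  have adj := adjD i iD; have Xi := XD i iD; have Yi := YD i iD.
  have iv := hat_adj_neq adj.
  have uniX j : hat_adj v j -> X j = c -> j = i.
    by move=> aj Xj; apply/set1P; rewrite -Di inE aj Xj eqxx.
  have uniY j : hat_adj v j -> Y j = c -> j = i.
    by move=> aj Yj; apply/set1P; rewrite -Di /D -DE inE aj Yj eqxx.
  have vX := notin_flip_cluster XY nXY ncY iv Xi.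
  have vY := notin_flip_cluster YX nYX ncX iv Yi.
  have hX := half_drift_single lf XY ncX adj Xi uniX vX.
  have hY := half_drift_single lNf YX ncY adj Yi uniY vY.
  have b1 := beta1 adj; rewrite Di big_set1.
  set C := flip_cluster Y i (X v) in vX hX.
  set C' := flip_cluster X i (Y v) in vY hY.
  have iC : i \in C by apply: mem_flip_cluster.
  have iC' : i \in C' by apply: mem_flip_cluster.
  have a1 : (1 <= #|C|)%N by apply: card_flip_cluster_gt0.
  have a1' : (1 <= #|C'|)%N by apply: card_flip_cluster_gt0.
  have q01 a : (1 <= a)%N -> 0 <= p a - p a.+1 <= 1.
    move=> h; rewrite subr_ge0 p_noninc //=.
    by have := p_le1 h; have := p_ge0 a.+1; lra.
  have dX : f Y - f (flip_fun Y i (X v)) <= cweight C by apply: lipschitz_flipN.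
  have dY : f (flip_fun X i (Y v)) - f X <= cweight C' by apply: lipschitz_flip.
  have dXY : f (flip_fun X i (Y v)) - f (flip_fun Y i (X v)) <=
      W + (cweight C + cweight C' - wt i).
    apply: (@le_trans _ _ (cweight (v |: (C :|: C')))); last first.
      by apply: le_trans (cweightU1 _ _) _; rewrite lerD2l cweightU.
    apply: lipschitz_le => // u; rewrite !inE !negb_or => /and3P[uv uC uC'].
    by rewrite !flip_fun_out // XY.
  have mass := @pair_mass_le _ _ _ _ _ _ (wt i) (W - (f X - f Y)) (q01 _ a1) (q01 _ a1') G0 dX dY.
  have {}mass := mass ltac:(lra).
  have ple := pair_q_le i a1 a1'.
  have leC := ler_wpM2l (proj1 (andP (q01 _ a1))) (cweight_mem iC).
  have leC' := ler_wpM2l (proj1 (andP (q01 _ a1'))) (cweight_mem iC').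
  have h1 : p #|C|.+1 * (W - (f X - f Y)) <= 2^-1 * (W - (f X - f Y)).
    by rewrite ler_wpM2r // p_half.
  have h2 : p #|C'|.+1 * (W - (f X - f Y)) <= 2^-1 * (W - (f X - f Y)).
    by rewrite ler_wpM2r // p_half.
  rewrite -D1 in slots.
  by lra.
- have le2 := sum_beta_ge adjD D2.
  have rX := p_flip_le_rho lf XY (leq_ltn_trans D2 cardX).
  have rY := p_flip_le_rho lNf YX (leq_ltn_trans D2 cardY).
  have terms : \sum_(i in D) (if #|flip_cluster Y i (X v)| == 1%N
      then f Y - f (flip_fun Y i (X v)) else mu) +
    \sum_(i in D) (if #|flip_cluster X i (Y v)| == 1%N
      then - f X - - f (flip_fun X i (Y v)) else mu) <=
    #|D|%:R * (W - (f X - f Y)) + \sum_(i in D) (wt i + mu).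
    rewrite mulr_natl -sumr_const -!big_split /=; apply: ler_sum => i iD.
    have muw := mu_le_wt i; have w0 := wt_ge0 i; have mu0 := mu_ge0.
    have dX := lipschitz_flipN Y i (X v) lf.
    have dY := lipschitz_flip X i (Y v) lf.
    have memX := mem_flip_cluster X i (Y v); have memY := mem_flip_cluster Y i (X v).
    case: ifP => [/eqP cX|_]; case: ifP => [/eqP cY|_].
    + have dXY : f (flip_fun X i (Y v)) - f (flip_fun Y i (X v)) <= W + wt i.
        apply: (@le_trans _ _ (cweight (v |: [set i]))); last first.
          by apply: le_trans (cweightU1 _ _) _; rewrite cweight1.
        have cs1 (Z : col) d : #|flip_cluster Z i d| = 1%N -> flip_cluster Z i d = [set i].
          move/eqP/cards1P => [j ej]; have := mem_flip_cluster Z i d.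
          by rewrite ej => /set1P ->.
        apply: lipschitz_le => // u; rewrite !inE negb_or => /andP[uv ui].
        have uX : u \notin flip_cluster X i (Y v) by rewrite cs1 // inE.
        have uY : u \notin flip_cluster Y i (X v) by rewrite cs1 // inE.
        by rewrite !flip_fun_out // XY.
      by lra.
    + by rewrite (cweight_card1 memY cX) in dX; lra.
    + by rewrite (cweight_card1 memX cY) in dY; lra.
    + by lra.
  have h1 : p #|flip_cluster X v c| * (W - (f X - f Y)) <= 2^-1 * (W - (f X - f Y)).
    by rewrite ler_wpM2r // p_half // (leq_trans _ cardX) // ltnW.
  have h2 : p #|flip_cluster Y v c| * (W - (f X - f Y)) <= 2^-1 * (W - (f X - f Y)).
    by rewrite ler_wpM2r // p_half // (leq_trans _ cardY) // ltnW.
  rewrite -natr1 in slots.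
  by lra.
Qed.

End Budget.
End Drift.

(* In the last five fields, [both] and [one] say whether the disagreeing edge,  *)
(* then its neighbour, lies in both graphs or in one. The suffix [2] marks the  *)
(* share of one of several neighbours of the same colour; the others concern a  *)
(* colour seen exactly once. The omitted combinations follow.                   *)
Record contractive (R : realType) (p : nat -> R) (w r mu rho kappa : R) : Prop := {
  contr_w : 4^-1 <= w <= 1;
  contr_r : 0 <= r;
  contr_mu : 0 <= mu;
  contr_rho : 0 <= rho;
  contr_kappa : 0 <= kappa;
  contr_p1 : p 1%N = 1;
  contr_p_ge0 : forall a, 0 <= p a;
  contr_p_half : forall a, (2 <= a)%N -> p a <= 2^-1;
  contr_p_noninc : forall a, (1 <= a)%N -> p a.+1 <= p a;
  contr_p_r : forall a, (1 <= a)%N -> (a%:R - 1) * (p a - p a.+1) <= r;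
  contr_p_mu : forall a, (2 <= a)%N -> a%:R * p a <= mu;
  contr_p_rho : forall a, (3 <= a)%N -> (a%:R - 1) * p a <= rho;
  contr_mu_w : 2 * mu <= w * (1 - p 2);
  contr_r_w : r * (1 + w) <= w * (1 - p 2);
  contr_both_one : 1 + w * (1 - p 2) + r <= kappa / 4;
  contr_one_both : w + (1 - p 2) + r <= kappa * w / 2;
  contr_both_one2 : 1 / 2 + rho + w + mu <= kappa / 4;
  contr_both_both2 : 1 / 2 + rho + 1 + mu <= kappa / 2;
  contr_one_both2 : w / 2 + rho + 1 + mu <= kappa * w / 2 }.

(** * Edge weights and one-step contraction *)

Section Contraction.
Variables (R : realType) (V : finType) (E1 E2 : {set {set V}}) (k Delta : nat).
Local Notation E := (edge E1 E2).
Local Notation col := {ffun E -> 'I_k}.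
Variables (p : nat -> R) (w r mu rho kappa : R).
Hypothesis ctr : contractive p w r mu rho kappa.
Hypotheses (simple1 : simple_graph E1) (simple2 : simple_graph E2)
  (deg1 : (max_degree E1 <= Delta)%N) (deg2 : (max_degree E2 <= Delta)%N).
Implicit Types (X Y Z : col) (e i u v : E) (c : 'I_k) (f : col -> R).

Definition in_both e : bool := (val e \in E1) && (val e \in E2).

Definition edge_weight e : R := if in_both e then 1 else w.

Local Notation wt := edge_weight.

Let w_gt0 : 0 < w.
Proof. by case/andP: (contr_w ctr) => h _; apply: lt_le_trans h; rewrite invr_gt0 ltr0n. Qed.

Let w_le1 : w <= 1.
Proof. by case/andP: (contr_w ctr). Qed.

Lemma edge_weight_ge u : w <= wt u.
Proof. by rewrite /wt; case: ifP. Qed.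

Lemma edge_weight_le1 u : wt u <= 1.
Proof. by rewrite /wt; case: ifP. Qed.

Lemma edge_weight_ge0 u : 0 <= wt u.
Proof. exact: le_trans (ltW w_gt0) (edge_weight_ge u). Qed.

(** A neighbour's share of kappa Delta times the weight of [v]. For [v] in both graphs it is kappa /
    4 per graph containing the neighbour, so common neighbours count double. *)
Definition budget v i : R :=
  if in_both v then (if in_both i then kappa / 2 else kappa / 4) else kappa * w / 2.

Let p2_le1 : p 2 <= 1.
Proof. by apply: le_trans (contr_p_half ctr _) _ => //; lra. Qed.

Lemma budget1 v i : wt v + wt i * (1 - p 2) + r <= budget v i.
Proof.
have := contr_both_one ctr; have := contr_one_both ctr.
have : w * (1 - p 2) <= 1 - p 2 by rewrite ler_piMl // subr_ge0.
have := contr_both_both2 ctr; have := contr_rho ctr; have := contr_mu ctr.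
have := contr_p_ge0 ctr 2; have := contr_r_w ctr; have r0 := contr_r ctr.
have : r <= r * (1 + w) by rewrite ler_peMr // lerDl ltW.
have := w_gt0; have := w_le1; have := p2_le1.
by rewrite /budget /wt; case: ifP => _; case: ifP => _; lra.
Qed.

Lemma budget2 v i : wt v / 2 + rho + wt i + mu <= budget v i.
Proof.
have := contr_both_one2 ctr; have := contr_both_both2 ctr; have := contr_one_both2 ctr.
have := w_gt0; have := w_le1.
by rewrite /budget /wt; case: ifP => _; case: ifP => _; lra.
Qed.

Lemma degree_count (E' : {set {set V}}) v :
  (max_degree E' <= Delta)%N ->
  \sum_(i | hat_adj v i && (val i \in E')) 1 <= 2 * Delta%:R :> R.
Proof.
move=> deg'; have card_v : #|val v| = 2%N.
  by have := valP v; rewrite in_setU => /orP[/simple1|/simple2].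
apply: (@le_trans _ _ (\sum_(x in val v) \sum_(i : E | (val i \in E') && (x \in val i)) 1)).
  apply: ler_sum_cover => // i /andP[/and3P[_ /existsP[x /andP[xv xi]] _] iE].
  by exists x; rewrite ?iE.
have -> : 2 * Delta%:R = \sum_(x in val v) Delta%:R :> R.
  by rewrite sumr_const card_v mulr_natl.
apply: ler_sum => x _; rewrite sumr_const ler_nat.
apply: leq_trans (leq_trans _ deg'); last exact: (leq_bigmax x).
rewrite /degree -(card_imset _ val_inj).
apply/subset_leq_card/subsetP => y /imsetP[i]; rewrite !inE => /andP[iE xi] ->.
by rewrite iE xi.
Qed.

(** Each graph contains at most 2 Delta neighbours of [v]. If [v] lies in one graph only, all its
    neighbours lie in that graph. *)
Lemma sum_budget v : \sum_(i | hat_adj v i) budget v i <= kappa * Delta%:R * wt v.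
Proof.
have d1 := degree_count v deg1; have d2 := degree_count v deg2.
have kap := contr_kappa ctr; have w0 := ltW w_gt0.
rewrite /budget /wt; case: ifPn => vb.
  have -> : \sum_(i | hat_adj v i) (if in_both i then kappa / 2 else kappa / 4) =
    kappa / 4 * (\sum_(i | hat_adj v i && (val i \in E1)) 1 +
                 \sum_(i | hat_adj v i && (val i \in E2)) 1).
    have cnd (E' : {set {set V}}) : \sum_(i | hat_adj v i && (val i \in E')) 1 =
        \sum_(i | hat_adj v i) (val i \in E')%:R :> R.
      rewrite [LHS]big_mkcond [RHS]big_mkcond; apply: eq_bigr => i _ /=.
      by case: (hat_adj v i); case: (_ \in E').
    rewrite !cnd -big_split /= mulr_sumr; apply: eq_bigr => i _.
    have := valP i; rewrite in_setU /in_both.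
    by case: (val i \in E1); case: (val i \in E2) => //= _; lra.
  have : kappa / 4 * (\sum_(i | hat_adj v i && (val i \in E1)) 1 +
                 \sum_(i | hat_adj v i && (val i \in E2)) 1) <= kappa / 4 * (4 * Delta%:R).
    by rewrite ler_wpM2l ?divr_ge0 //; lra.
  by lra.
have : \sum_(i | hat_adj v i) 1 <= 2 * Delta%:R :> R.
  have := valP v; rewrite in_setU => /orP[v1|v2].
    suff -> : \sum_(i | hat_adj v i) 1 = \sum_(i | hat_adj v i && (val i \in E1)) 1 :> R by [].
    apply: eq_bigl => i; apply/idP/andP => [adj|[]//]; split=> //.
    by case/and3P: adj => _ _; move: vb; rewrite /in_both v1 /= => /negbTE ->; rewrite /= orbF.
  suff -> : \sum_(i | hat_adj v i) 1 = \sum_(i | hat_adj v i && (val i \in E2)) 1 :> R by [].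
  apply: eq_bigl => i; apply/idP/andP => [adj|[]//]; split=> //.
  by case/and3P: adj => _ _; move: vb; rewrite /in_both v2 andbT => /negbTE ->.
have kw : 0 <= kappa * w / 2 by rewrite divr_ge0 ?mulr_ge0.
move=> /(ler_wpM2l kw); rewrite mulr_sumr mulr1; lra.
Qed.

Let mu_wt u : 2 * mu <= wt u * (1 - p 2).
Proof.
by apply: le_trans (contr_mu_w ctr) _; rewrite ler_wpM2r ?edge_weight_ge // subr_ge0.
Qed.

Let r_wt u : r * (1 + wt u) <= wt u * (1 - p 2).
Proof.
have := contr_r_w ctr; have rw := contr_r ctr.
have := edge_weight_ge u; have := p2_le1; have w0 := w_gt0.
have : r <= 1 - p 2.
  apply: (@le_trans _ _ (r * (1 + w))); first by rewrite ler_peMr // lerDl ltW.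
  by apply: le_trans (contr_r_w ctr) _; rewrite ler_piMl // subr_ge0.
move=> h1 h2 h3 h4.
have : (wt u - w) * r <= (wt u - w) * (1 - p 2) by rewrite ler_wpM2l // subr_ge0.
by lra.
Qed.

Lemma good_drift f X Y v e c : lipschitz wt f -> {in predC1 v, X =1 Y} ->
  v \notin flip_cluster X e c -> v \notin flip_cluster Y e c ->
  flip_rate p X e c * (f (flip_fun X e c) - f (flip_fun Y e c) - (f X - f Y)) <=
  wt v - (f X - f Y).
Proof.
move=> lf XY vX vY; have FW := lipschitz_pair edge_weight_ge0 lf XY.
have ev : e != v by apply: contraNneq vX => ->; apply: mem_flip_cluster.
have le1 : f (flip_fun X e c) - f (flip_fun Y e c) <= wt v.
  apply: lipschitz_pair => // [|u uv]; first exact: edge_weight_ge0.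
  by rewrite !ffunE (flip_cluster_agree XY vX vY) !XY.
apply: (@le_trans _ _ (flip_rate p X e c * (wt v - (f X - f Y)))).
  by rewrite ler_wpM2l ?flip_rate_ge0 ?lerD2r //; apply: contr_p_ge0 ctr.
rewrite ler_piMl ?subr_ge0 // flip_rate_le1 //; first exact: contr_p1 ctr.
exact: contr_p_half ctr.
Qed.

Lemma color_drift f X Y v c : lipschitz wt f -> {in predC1 v, X =1 Y} -> X v != Y v ->
  half_drift p f X Y v c + half_drift p (fun Z => - f Z) Y X v c <=
    #|flip_cluster X v c|%:R * (wt v - (f X - f Y)) +
    \sum_(i | hat_adj v i && (X i == c)) budget v i - wt v.
Proof.
move=> lf XY nXY; have YX : {in predC1 v, Y =1 X} by move=> u uv; rewrite XY.
have nYX : Y v != X v by rewrite eq_sym.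
have lNf := lipschitzN lf.
have b1 i (_ : hat_adj v i) := budget1 v i; have b2 i (_ : hat_adj v i) := budget2 v i.
have FW := lipschitz_pair edge_weight_ge0 lf XY.
rewrite -big_set.
have [cX|ncX] := eqVneq c (X v).
  rewrite cX half_drift_id flip_cluster_id cards1 add0r mul1r.
  have h := half_drift_other edge_weight_ge0 edge_weight_le1 (contr_p1 ctr)
    (contr_p_ge0 ctr) (contr_p_half ctr) (contr_p_noninc ctr) (contr_r ctr)
    (contr_mu ctr) (contr_rho ctr) (contr_p_r ctr) (contr_p_mu ctr) mu_wt r_wt
    b1 b2 lNf YX nYX.
  apply: le_trans h _.
  have -> : [set i | hat_adj v i & Y i == X v] = [set i | hat_adj v i & X i == X v].
    apply/setP => i; rewrite !inE; case: (boolP (hat_adj v i)) => //= adj.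
    by rewrite (XY i) // inE hat_adj_neq.
  by rewrite opprK [- f Y + _]addrC.
have [cY|ncY] := eqVneq c (Y v).
  have h := half_drift_other edge_weight_ge0 edge_weight_le1 (contr_p1 ctr)
    (contr_p_ge0 ctr) (contr_p_half ctr) (contr_p_noninc ctr) (contr_r ctr)
    (contr_mu ctr) (contr_rho ctr) (contr_p_r ctr) (contr_p_mu ctr) mu_wt r_wt
    b1 b2 lf XY nXY.
  rewrite cY half_drift_id addr0; apply: le_trans h _; rewrite !lerD2r.
  by rewrite ler_peMl ?subr_ge0 // ler1n card_flip_cluster_gt0.
exact: (half_drift_pair edge_weight_ge0 edge_weight_le1 (contr_p1 ctr)
    (contr_p_ge0 ctr) (contr_p_half ctr) (contr_p_noninc ctr) (contr_r ctr)
    (contr_mu ctr) (contr_rho ctr) (contr_p_r ctr) (contr_p_mu ctr) (contr_p_rho ctr)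
    mu_wt r_wt b1 b2).
Qed.

Lemma drift_contract f X Y v : lipschitz wt f -> {in predC1 v, X =1 Y} -> X v != Y v ->
  flip_drift p f X - flip_drift p f Y <=
    (#|E| * k)%:R * (wt v - (f X - f Y)) + (kappa * Delta%:R - k%:R) * wt v.
Proof.
move=> lf XY nXY; rewrite (drift_split p f XY).
set G := wt v - (f X - f Y).
(* One slack per pair (edge, colour); pairs whose X-cluster contains [v] are regrouped by the colour
   given to [v]. *)
have -> : (#|E| * k)%:R * G = \sum_(e : E) \sum_(c | v \notin flip_cluster X e c) G +
    \sum_(c < k) #|flip_cluster X v c|%:R * G.
  rewrite natrM -mulrA !mulr_natl; transitivity (\sum_(e : E) \sum_(c < k) G).
    by rewrite !sumr_const card_ord.
  rewrite addrC; transitivity (\sum_(e : E) \sum_(c | v \in flip_cluster X e c) G +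
     \sum_(e : E) \sum_(c | v \notin flip_cluster X e c) G).
    by rewrite -big_split; apply: eq_bigr => e _; rewrite (bigID (fun c => v \in flip_cluster X e c)).
  rewrite (sum_cluster_reindex X v (fun _ _ => G)); congr (_ + _).
  by apply: eq_bigr => c _; rewrite sumr_const mulr_natl.
rewrite -addrA; apply: lerD.
  apply: ler_sum => e _; rewrite [leLHS]big_mkcond [leRHS]big_mkcond.
  apply: ler_sum => c _ /=; case: (boolP (v \in flip_cluster X e c)) => //= vX.
  (* When only the Y-cluster contains [v], the move is accounted for in the half drifts and its
     slack is left over. *)
  case: ifP => vY; first exact: good_drift.
  by rewrite subr_ge0; apply: lipschitz_pair XY => //; apply: edge_weight_ge0.
apply: (@le_trans _ _ (\sum_c (#|flip_cluster X v c|%:R * G +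
    \sum_(i | hat_adj v i && (X i == c)) budget v i - wt v))).
  by apply: ler_sum => c _; apply: color_drift.
rewrite !big_split /= -addrA lerD2l mulrBl; apply: lerD; last first.
  by rewrite sumr_const card_ord mulNrn mulr_natl.
rewrite (exchange_big_dep (hat_adj v)) /=; last by move=> c i _ /andP[].
apply: le_trans (sum_budget v); apply: ler_sum => i adj.
rewrite (eq_bigl (fun c => c == X i)); first by rewrite big_pred1_eq.
by move=> c; rewrite adj eq_sym.
Qed.

Definition flip_step f X : R := f X + (#|E| * k)%:R^-1 * flip_drift p f X.

Variable eta : R.
Hypotheses (k_gt0 : (0 < k)%N) (m_gt0 : (0 < #|E|)%N) (eta01 : 0 < eta < 1)
  (kappa_k : kappa * Delta%:R <= (1 - eta) * k%:R).

Lemma flip_step_adjacent f X Y v : lipschitz wt f -> {in predC1 v, X =1 Y} ->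
  flip_step f X - flip_step f Y <= (1 - eta / #|E|%:R) * cdist wt X Y.
Proof.
move=> lf XY; case: (eqVneq (X v) (Y v)) => [XYv|nXY].
  have -> : X = Y by apply/ffunP => u; case: (eqVneq u v) => [->|/XY].
  by rewrite subrr /cdist big_pred0 ?mulr0 // => u; rewrite eqxx.
have -> : cdist wt X Y = wt v.
  rewrite /cdist (bigD1 v) //= big1 ?addr0 // => u /andP[neq uv].
  by rewrite XY // eqxx in neq.
have := drift_contract lf XY nXY.
have m0 : 0 < #|E|%:R :> R by rewrite ltr0n.
have k0 : 0 < k%:R :> R by rewrite ltr0n.
have le2 : (kappa * Delta%:R - k%:R) * wt v <= - (eta * k%:R) * wt v.
  by rewrite ler_wpM2r ?edge_weight_ge0 //; have := kappa_k; lra.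
move=> le1; have {le1 le2} := le_trans le1 (lerD (lexx _) le2).
rewrite /flip_step natrM.
set D1 := flip_drift p f X; set D2 := flip_drift p f Y.
have mk0 : 0 < (#|E|%:R * k%:R)^-1 :> R by rewrite invr_gt0 mulr_gt0.
move=> /(ler_wpM2l (ltW mk0)).
have -> : (#|E|%:R * k%:R)^-1 * (#|E|%:R * k%:R * (wt v - (f X - f Y)) + - (eta * k%:R) * wt v) =
  (1 - eta / #|E|%:R) * wt v - (f X - f Y).
  by field; rewrite !gt_eqF.
by lra.
Qed.

Lemma cdist_pathP f (L : R) :
  (forall X Y v, {in predC1 v, X =1 Y} -> f X - f Y <= L * cdist wt X Y) ->
  forall X Y, f X - f Y <= L * cdist wt X Y.
Proof.
move=> adj X Y; move: {2}#|_| (leqnn #|[set u | X u != Y u]|) => n.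
elim: n X => [|n IH] X.
  rewrite leqn0 cards_eq0 => /eqP XY0.
  have -> : X = Y.
    apply/ffunP => u; apply/eqP; apply: contraT => neq.
    by have := in_set0 u; rewrite -XY0 inE neq.
  by rewrite subrr /cdist big_pred0 ?mulr0 // => u; rewrite eqxx.
case: (set_0Vmem [set u | X u != Y u]) => [XY0 _|[v]].
  by apply: IH; rewrite XY0 cards0.
rewrite inE => neq card_le.
pose Z : col := [ffun u => if u == v then Y v else X u].
have XZ : {in predC1 v, X =1 Z} by move=> u; rewrite inE ffunE => /negbTE ->.
have -> : cdist wt X Y = cdist wt X Z + cdist wt Z Y.
  rewrite /cdist (bigD1 v) //=; congr (_ + _).
    rewrite (bigD1 v) /= ?ffunE ?eqxx // big1 ?addr0 // => u /andP[neqXZ uv].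
    by rewrite XZ // eqxx in neqXZ.
  by apply: eq_bigl => u; rewrite ffunE; case: (eqVneq u v) => [->|_]; rewrite ?eqxx ?andbF ?andbT.
have le1 := adj X Z v XZ.
have le2 : f Z - f Y <= L * cdist wt Z Y.
  apply: IH; rewrite -ltnS; apply: leq_trans card_le.
  rewrite [X in (_ < X)%N](cardsD1 v) inE neq ltnS.
  apply/subset_leq_card/subsetP => u; rewrite !inE ffunE.
  by case: (eqVneq u v) => [->|]; rewrite ?eqxx.
by lra.
Qed.

Lemma rate_eta_gt0 : 0 < 1 - eta / #|E|%:R.
Proof.
rewrite subr_gt0 ltr_pdivrMr ?ltr0n // mul1r.
by case/andP: eta01 => _ h; apply: lt_le_trans h _; rewrite ler1n.
Qed.

Lemma iter_flip_step f t : lipschitz wt f ->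
  forall X Y, iter t flip_step f X - iter t flip_step f Y <=
    (1 - eta / #|E|%:R) ^+ t * cdist wt X Y.
Proof.
move=> lf; elim: t => [|t IH] X Y; first by rewrite expr0 mul1r; apply: lf.
set L := _ ^+ t in IH; set g := iter t flip_step f in IH.
have L0 : 0 < L by rewrite exprn_gt0 // rate_eta_gt0.
(* Rescaling makes [g] 1-Lipschitz, so the one-step bound applies again; [flip_step] is linear. *)
have lg : lipschitz wt (fun Z => L^-1 * g Z).
  by move=> Z Z'; rewrite -mulrBr mulrC ler_pdivrMr // mulrC; apply: IH.
have := cdist_pathP (fun X Y v => @flip_step_adjacent _ X Y v lg) X Y.
have scale Z : flip_step (fun Z => L^-1 * g Z) Z = L^-1 * flip_step g Z.
  rewrite /flip_step /flip_drift mulrDr; congr (_ + _).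
  rewrite mulrCA; congr (_ * _); rewrite mulr_sumr; apply: eq_bigr => e _.
  rewrite mulr_sumr; apply: eq_bigr => c _.
  by rewrite -mulrBr mulrCA.
rewrite !scale -mulrBr mulrC ler_pdivrMr // exprS -/L iterS -/g.
by rewrite [X in _ <= X -> _]mulrAC.
Qed.

End Contraction.

(** * Stationarity of the uniform distribution and action of the kernel *)

Lemma connect_eq_closed (T : finType) (e1 e2 : rel T) (C : {pred T}) x :
  (forall y z, y \in C -> e1 y z = e2 y z) ->
  (forall y z, y \in C -> e1 y z -> z \in C) ->
  x \in C -> connect e1 x =1 connect e2 x.
Proof.
move=> eqC closed xC y.
have eq_path q : path e1 x q = path e2 x q.
  elim: q x xC => //= z q IH x xC; rewrite -eqC //.
  by case: (boolP (e1 x z)) => //= xz; apply: IH; apply: closed xz.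
by apply/connectP/connectP => -[q pth ->]; exists q; rewrite ?eq_path // -eq_path.
Qed.

Section Chain.
Variables (R : realType) (V : finType) (E1 E2 : {set {set V}}) (k : nat).
Local Notation E := (edge E1 E2).
Local Notation col := {ffun E -> 'I_k}.
Local Notation Omega := (sim_coloring E1 E2 k).
Implicit Types (sigma tau : Omega) (e : E) (c : 'I_k) (f : col -> R).

Lemma flip_fun_at (X : col) e c : flip_fun X e c e = c.
Proof. by rewrite ffunE mem_flip_cluster swap_color_l. Qed.

(** Swapping two colours on a whole component preserves adjacency inside it, and properness prevents
    the swapped component from growing. *)
Lemma flip_cluster_flip (X : col) e c : sim_proper X ->
  flip_cluster (flip_fun X e c) e (X e) = flip_cluster X e c.
Proof.
move=> /sim_properP pr; case: (eqVneq c (X e)) => [->|nc].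
  by rewrite flip_fun_id flip_cluster_id.
set C := flip_cluster X e c.
have CE : C = [set g | connect (alternates X (X e) c) e g] by apply: flip_clusterE.
rewrite flip_clusterE flip_fun_at; last by rewrite eq_sym.
rewrite CE; apply/setP => g; rewrite !inE; apply/esym.
have closed y z : y \in C -> alternates X (X e) c y z -> z \in C.
  by rewrite CE !inE => yC yz; apply: connect_trans yC (connect1 yz).
apply: (@connect_eq_closed _ _ _ (mem C)) => [y z yC|y z|]; last exact: mem_flip_cluster.
  rewrite /alternates; case: (boolP (hat_adj y z)) => //= adj.
  have alt := closed y z yC; rewrite /alternates adj /= in alt.
  rewrite !ffunE -/C yC.
  have := pr _ _ adj; have := flip_cluster_color yC.
  case: (boolP (z \in C)) => zC.
    have := flip_cluster_color zC; rewrite /swap_color.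
    by move=> /orP[]/eqP -> /orP[]/eqP ->; rewrite ?eqxx ?(negbTE nc) ?(eq_sym (X e))
      ?(negbTE nc) ?eqxx.
  (* An edge outside the cluster could join it only by having the old colour of its neighbour [y],
     against properness. *)
  move/contra: alt => /(_ zC) /negbTE ->; rewrite /swap_color.
  by move=> /orP[]/eqP ->; rewrite ?eqxx ?(negbTE nc) ?(eq_sym (X e)) ?(negbTE nc) ?eqxx /=
    1?eq_sym => /negbTE ->; rewrite ?andbF ?orbF.
exact: closed.
Qed.

Lemma flip_fun_flip (X : col) e c : sim_proper X ->
  flip_fun (flip_fun X e c) e (X e) = X.
Proof.
move=> pr; apply/ffunP => g; rewrite [LHS]ffunE flip_cluster_flip // flip_fun_at.
case: ifP => gC; rewrite ffunE gC //.
by case/orP: (flip_cluster_color gC) => /eqP ->; rewrite !(swap_color_l, swap_color_r).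
Qed.

Variable p : nat -> R.

(* Flipping the same cluster back is an involution that preserves rates, so    *)
(* that the uniform distribution is stationary.                                *)
Lemma sum_flip_drift f : \sum_(sigma : Omega) flip_drift p f (val sigma) = 0.
Proof.
rewrite /flip_drift exchange_big big1 //= => e _.
have := pair_bigA _ (fun (s : Omega) c =>
  flip_rate p (val s) e c * (f (flip_fun (val s) e c) - f (val s))) => /= ->.
(* Flip, and remember the old colour of [e] as the colour for flipping back. *)
pose h (sc : Omega * 'I_k) := (flip_move sc.1 e sc.2, val sc.1 e).
have hK : involutive h.
  move=> [s c]; rewrite /h /=; congr pair; last exact: flip_fun_at.
  by apply/val_inj => /=; apply: flip_fun_flip; apply: valP.
under eq_bigr do rewrite mulrBr.
rewrite sumrB; apply/eqP; rewrite subr_eq0; apply/eqP.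
rewrite [LHS](reindex_inj (inv_inj hK)) /=; apply: eq_bigr => -[s c] _ /=.
by rewrite /flip_rate flip_cluster_flip ?flip_fun_flip //; apply: valP.
Qed.

Hypothesis mk_gt0 : (0 < #|E| * k)%N.

Let mE : #|E1 :|: E2| = #|E|.
Proof. by rewrite card_sig; apply: eq_card => e; rewrite !inE. Qed.

Lemma flip_kernel_act f sigma :
  \sum_tau flip_kernel p sigma tau * f (val tau) = flip_step p f (val sigma).
Proof.
have pick (g : Omega -> R) s : \sum_tau (s == tau)%:R * g tau = g s.
  rewrite (bigD1 s) //= eqxx mul1r big1 ?addr0 // => t ts.
  by rewrite eq_sym (negbTE ts) mul0r.
transitivity (\sum_e \sum_(c < k) (#|E| * k)%:R^-1 *
    (f (val sigma) + flip_rate p (val sigma) e c *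
       (f (flip_fun (val sigma) e c) - f (val sigma)))).
  rewrite /flip_kernel mE; under eq_bigr do rewrite mulr_suml.
  rewrite exchange_big; apply: eq_bigr => e _ /=.
  under eq_bigr do rewrite mulr_suml.
  rewrite exchange_big; apply: eq_bigr => c _ /=.
  set a := (#|E| * k)%:R^-1; set q := flip_rate p (val sigma) e c.
  transitivity (\sum_tau (a * q * ((flip_move sigma e c == tau)%:R * f (val tau)) +
     a * (1 - q) * ((sigma == tau)%:R * f (val tau)))).
    by apply: eq_bigr => t _; rewrite /q /flip_rate; ring.
  by rewrite big_split /= -!mulr_sumr !(pick (fun t => f (val t))) /=; ring.
under eq_bigr do rewrite -mulr_sumr big_split /=.
rewrite -mulr_sumr big_split /= mulrDr /flip_step /flip_drift; congr (_ + _).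
under eq_bigr do rewrite sumr_const card_ord.
rewrite sumr_const -mulrnA (mulnC k) -[f _ *+ _]mulr_natl mulKf //.
by rewrite pnatr_eq0 -lt0n.
Qed.

Lemma kernel_pow_act t f sigma :
  \sum_tau kernel_pow (flip_kernel p) t sigma tau * f (val tau) =
  iter t (flip_step p) f (val sigma).
Proof.
elim: t sigma => [|t IH] sigma /=.
  rewrite (bigD1 sigma) //= eqxx mul1r big1 ?addr0 // => s ns.
  by rewrite eq_sym (negbTE ns) mul0r.
under eq_bigr do rewrite mulr_suml.
rewrite exchange_big /=.
under eq_bigr => z _ do
  (under eq_bigr do rewrite -mulrA; rewrite -mulr_sumr IH).
exact: flip_kernel_act.
Qed.

Lemma sum_flip_step t f :
  \sum_(sigma : Omega) iter t (flip_step p) f (val sigma) = \sum_(sigma : Omega) f (val sigma).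
Proof.
elim: t => //= t <-; rewrite /flip_step big_split /= -mulr_sumr.
by rewrite sum_flip_drift mulr0 addr0.
Qed.

End Chain.

(** * From contraction to mixing time *)

Section Mixing.
Variables (R : realType) (V : finType) (E1 E2 : {set {set V}}) (k Delta : nat).
Local Notation E := (edge E1 E2).
Local Notation col := {ffun E -> 'I_k}.
Local Notation Omega := (sim_coloring E1 E2 k).
Variables (p : nat -> R) (w r mu rho kappa eta : R).
Hypothesis ctr : contractive p w r mu rho kappa.
Hypotheses (simple1 : simple_graph E1) (simple2 : simple_graph E2)
  (deg1 : (max_degree E1 <= Delta)%N) (deg2 : (max_degree E2 <= Delta)%N)
  (k_gt0 : (0 < k)%N) (eta01 : 0 < eta < 1)
  (kappa_k : kappa * Delta%:R <= (1 - eta) * k%:R).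

Let mE : #|E1 :|: E2| = #|E|.
Proof. by rewrite card_sig; apply: eq_card => e; rewrite !inE. Qed.

(** Test with w / 2 times the sign of the deviation, extended by 0 to improper maps: its oscillation
    is at most w, the least distance of distinct maps, so it is 1-Lipschitz. By stationarity its
    uniform average does not change in time, and all distances are at most m. *)
Lemma dTV_flip_le t (sigma : Omega) : (0 < #|E|)%N ->
  dTV (kernel_pow (flip_kernel p) t sigma) (uniform_dist R Omega) <=
    #|E|%:R / w * (1 - eta / #|E|%:R) ^+ t.
Proof.
move=> m_gt0; set K := kernel_pow _ t sigma.
have mk0 : (0 < #|E| * k)%N by rewrite muln_gt0 m_gt0.
have [/andP[w4 w1]] := (contr_w ctr, ctr) => _.
have w0 : 0 < w by apply: lt_le_trans w4; rewrite invr_gt0 ltr0n.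
have N0 : (0 < #|Omega|)%N by apply/card_gt0P; exists sigma.
pose s (y : Omega) : R := if uniform_dist R Omega y <= K y then 1 else -1.
pose f0 (X : col) : R := w / 2 * (if insub X is Some y then s y else 0).
have s1 y : -1 <= s y <= 1 by rewrite /s; case: ifP => _; lra.
have f0_bd X : - (w / 2) <= f0 X <= w / 2.
  have w2 : 0 <= w / 2 by lra.
  rewrite /f0; case: insub => [y|]; last by lra.
  by have /andP[/(ler_wpM2l w2) h1 /(ler_wpM2l w2) h2] := s1 y; lra.
have f0E y : f0 (val y) = w / 2 * s y by rewrite /f0 valK.
have lf0 : lipschitz (edge_weight w) f0.
  move=> X Y; case: (eqVneq X Y) => [->|neq].
    by rewrite subrr; apply: sumr_ge0 => u _; apply: (edge_weight_ge0 ctr).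
  have [u neq_u] : exists u, X u != Y u.
    apply/existsP; apply: contraNT neq; rewrite negb_exists => /forallP h.
    by apply/eqP/ffunP => u; apply/eqP; rewrite -[_ == _]negbK h.
  apply: (@le_trans _ _ w); first by have := f0_bd X; have := f0_bd Y; lra.
  apply: le_trans (edge_weight_ge ctr u) _.
  rewrite /cdist (bigD1 u) //= lerDl sumr_ge0 // => *.
  exact: (edge_weight_ge0 ctr).
have dTVE : dTV K (uniform_dist R Omega) =
    2^-1 * (\sum_y K y * s y - \sum_y #|Omega|%:R^-1 * s y).
  rewrite /dTV; congr (_ * _); rewrite -sumrB; apply: eq_bigr => y _.
  rewrite -mulrBl /s /uniform_dist; case: (leP _ (K y)) => h.
    by rewrite mulr1 ger0_norm // subr_ge0.
  by rewrite ltr0_norm ?subr_lt0 // mulrN1.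
have it1 : iter t (flip_step p) f0 (val sigma) = w / 2 * \sum_y K y * s y.
  rewrite -(kernel_pow_act p mk0) mulr_sumr; apply: eq_bigr => y _.
  by rewrite f0E mulrCA.
have it2 : \sum_y iter t (flip_step p) f0 (val (y : Omega)) = w / 2 * \sum_y s y.
  by rewrite sum_flip_step mulr_sumr; apply: eq_bigr => y _; rewrite f0E.
have NR : 0 < #|Omega|%:R :> R by rewrite ltr0n.
have cst (x : R) : \sum_(y : Omega) x = #|Omega|%:R * x.
  by rewrite sumr_const mulr_natl.
have eq1 : dTV K (uniform_dist R Omega) = (w * #|Omega|%:R)^-1 *
    \sum_y (iter t (flip_step p) f0 (val sigma) - iter t (flip_step p) f0 (val (y : Omega))).
  rewrite sumrB it2 it1 cst dTVE -mulr_sumr.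
  by field; rewrite !gt_eqF.
rewrite eq1.
set L := _ ^+ t.
have L0 : 0 <= L by rewrite exprn_ge0 // ltW // rate_eta_gt0.
have le1 : \sum_(y : Omega) (iter t (flip_step p) f0 (val sigma) -
     iter t (flip_step p) f0 (val y)) <= \sum_(y : Omega) (L * #|E|%:R).
  apply: ler_sum => y _.
  apply: le_trans (iter_flip_step ctr simple1 simple2 deg1 deg2 k_gt0 m_gt0 eta01 kappa_k t lf0 _ _) _.
  apply: ler_wpM2l => //; apply: (@le_trans _ _ (cweight (edge_weight w) [set: E])).
    apply: cdist_le => [u|u]; first exact: (edge_weight_ge0 ctr).
    by rewrite inE.
  by rewrite -cardsT; apply: cweight_card; apply: (edge_weight_le1 ctr).
rewrite cst in le1.
have wN : 0 <= (w * #|Omega|%:R)^-1 by rewrite invr_ge0 mulr_ge0 // ltW.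
apply: le_trans (ler_wpM2l wN le1) _.
rewrite le_eqVlt; apply/orP; left; apply/eqP.
by field; rewrite !gt_eqF.
Qed.

Lemma card_edge_le : (#|E| <= #|V| ^ 2)%N.
Proof.
rewrite -mE; apply: (@leq_trans #|[set A : {set V} | #|A| == 2%N]|).
  apply/subset_leq_card/subsetP => e; rewrite !inE => /orP[/simple1 ->|/simple2 ->] //.
rewrite card_draws bin2 -divn2 -mulnn.
by apply: leq_trans (leq_div _ _) _; rewrite leq_mul // leq_pred.
Qed.

(** The constant 6 gives decay n^-6. With m <= n^2 and w >= 1/4 the bound becomes 4 / n^4, at most
    1/4 as n >= 2. *)
Lemma dTV_small t (sigma : Omega) : (0 < #|E|)%N ->
  6 / eta * (#|E|%:R * ln #|V|%:R) <= t%:R ->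
  dTV (kernel_pow (flip_kernel p) t sigma) (uniform_dist R Omega) <= 4^-1.
Proof.
move=> m_gt0 tge; apply: le_trans (dTV_flip_le t sigma m_gt0) _.
have /andP[eta0 eta1] := eta01.
have /andP[w4 w1] := contr_w ctr.
have m0 : 0 < #|E|%:R :> R by rewrite ltr0n.
set n := #|V|.
have n2 : (2 <= n)%N.
  have /card_gt0P[e _] := m_gt0.
  have : #|val e| = 2%N by have := valP e; rewrite in_setU => /orP[/simple1|/simple2].
  by move <-; apply: max_card.
have n0 : 0 < n%:R :> R by rewrite ltr0n ltnW.
have le1 : 1 - eta / #|E|%:R <= expR (- (eta / #|E|%:R)) by rewrite expR_ge1Dx.
have le2 : (1 - eta / #|E|%:R) ^+ t <= expR (- (6 * ln n%:R)).
  apply: (@le_trans _ _ (expR (- (eta / #|E|%:R)) ^+ t)).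
    by apply: lerXn2r => //; rewrite nnegrE ?expR_ge0 // ltW // rate_eta_gt0.
  rewrite -expRM_natl ler_expR mulrN lerN2.
  have : 0 <= eta / #|E|%:R by rewrite divr_ge0 // ltW.
  move=> /(ler_wpM2r) /(_ _ _ tge).
  by have -> : 6 / eta * (#|E|%:R * ln n%:R) * (eta / #|E|%:R) = 6 * ln n%:R
    by field; rewrite !gt_eqF.
have ln6 : expR (- (6 * ln n%:R)) = (n%:R ^+ 6)^-1 :> R.
  by rewrite expRN -[6]/(6%:R) expRM_natl lnK // posrE.
rewrite ln6 in le2.
have mw : #|E|%:R / w <= n%:R ^+ 2 * 4.
  apply: ler_pM => //.
  - by rewrite invr_ge0; apply: le_trans w4; rewrite invr_ge0 ler0n.
  - by rewrite -natrX ler_nat card_edge_le.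
  - by rewrite -[leRHS]invrK lef_pV2 // posrE ?invr_gt0 ?ltr0n // (lt_le_trans _ w4) // invr_gt0 ltr0n.
apply: (@le_trans _ _ (n%:R ^+ 2 * 4 * (n%:R ^+ 6)^-1)).
  apply: ler_pM => //; last exact: exprn_ge0 (ltW (rate_eta_gt0 _ _)).
  by rewrite divr_ge0 // ltW // (lt_le_trans _ w4) // invr_gt0 ltr0n.
have -> : n%:R ^+ 2 * 4 * (n%:R ^+ 6)^-1 = 4 / n%:R ^+ 4 :> R by field; rewrite gt_eqF.
rewrite ler_pdivrMr ?exprn_gt0 // -ler_pdivrMl ?invr_gt0 ?ltr0n // invrK.
have -> : 4 * 4 = 2%:R ^+ 4 :> R by ring.
by apply: lerXn2r; rewrite ?nnegrE ?ler0n ?ler_nat.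
Qed.

(** The summand 2 pays for rounding the time up: m ln n >= 1/2 once there is an edge. Without edges
    there is a single coloring and time 0 suffices. *)
Lemma flip_mixing_time_le :
  (flip_mixing_time E1 E2 k p <=
     ((6 / eta + 2) * (#|E1 :|: E2|%:R * ln #|V|%:R))%:E)%E.
Proof.
have /andP[eta0 eta1] := eta01.
have bound (b : R) : 0 <= b ->
   (forall sigma : Omega, exists2 t : nat,
      dTV (kernel_pow (flip_kernel p) t sigma) (uniform_dist R Omega) <= 4^-1 &
      t%:R <= b) -> (flip_mixing_time E1 E2 k p <= b%:E)%E.
  move=> b0 h; rewrite /flip_mixing_time /mixing_time.
  elim/big_ind: _ => [|x y hx hy|sigma _]; first by rewrite lee_fin.
    by rewrite ge_max hx hy.
  have [t ht tb] := h sigma.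
  apply: (@le_trans _ _ (t%:R%:E)); last by rewrite lee_fin.
  by apply: ereal_inf_lbound; exists t.
rewrite mE; case: (posnP #|E|) => [m0|m_gt0].
  rewrite m0 mul0r mulr0; apply: bound => // sigma; exists 0%N => //.
  have one (x : Omega) : x = sigma.
    apply/val_inj/ffunP => e; have := card0_eq m0 e; by rewrite inE.
  have cardO : #|Omega| = 1%N.
    by rewrite -(card1 sigma); apply: eq_card => x; rewrite !inE (one x) eqxx.
  rewrite /dTV big1 ?mulr0 ?invr_ge0 ?ler0n // => x _.
  by rewrite /uniform_dist cardO /= (one x) eqxx invr1 subrr normr0.
have n2 : (2 <= #|V|)%N.
  have /card_gt0P[e _] := m_gt0.
  have : #|val e| = 2%N by have := valP e; rewrite in_setU => /orP[/simple1|/simple2].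
  by move <-; apply: max_card.
have ln2 : 2^-1 <= ln #|V|%:R :> R.
  apply: (@le_trans _ _ (ln 2)); last by rewrite ler_ln ?posrE ?ltr0n ?ler_nat // ltnW.
  rewrite -ler_expR lnK ?posrE ?ltr0n //.
  have : 2^-1 <= expR (- 2^-1) :> R.
    by apply: le_trans (expR_ge1Dx _); lra.
  have := expRxMexpNx_1 (2^-1 : R); have := expR_gt0 (2^-1 : R).
  set x := expR 2^-1; set y := expR (- 2^-1) => x0 xy y2.
  have := ler_wpM2l (ltW x0) y2; rewrite xy; lra.
have mln : 1 <= 2 * (#|E|%:R * ln #|V|%:R) :> R.
  have m1 : 1 <= #|E|%:R :> R by rewrite ler1n.
  have : 1 * 2^-1 <= #|E|%:R * ln #|V|%:R :> R by apply: ler_pM => //; rewrite invr_ge0.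
  by lra.
set z := 6 / eta * (#|E|%:R * ln #|V|%:R).
have z0 : 0 <= z by rewrite mulr_ge0 ?divr_ge0 ?(ltW eta0) //; lra.
apply: bound => [|sigma]; first by rewrite mulrDl addr_ge0 //; lra.
exists (Num.truncn z).+1.
  by apply: dTV_small => //; apply/ltW; apply: truncnS_gt.
rewrite mulrDl -/z -natr1; apply: lerD => //.
by rewrite truncn_le.
Qed.

End Mixing.

(** * The two choices of flip probabilities *)

Lemma glauber_kernelE (R : realType) (V : finType) (E1 E2 : {set {set V}}) (k : nat) :
  @glauber_kernel V E1 E2 k R = flip_kernel (fun a => (a == 1%N)%:R).
Proof.
apply/funext => sigma; apply/funext => tau; apply: eq_bigr => e _; apply: eq_bigr => c _.
congr (_ * _); rewrite /=.
set X := val sigma; have pr := valP sigma; have /sim_properP prP := pr.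
have [cX|nc] := eqVneq c (X e).
  have -> : glauber_move sigma e c = sigma.
    apply/val_inj; rewrite /= /glauber_fun; case: ifP => // _.
    by apply/ffunP => g; rewrite ffunE; case: (eqVneq g e) => [->|].
  have -> : flip_move sigma e c = sigma by apply/val_inj; rewrite /= cX flip_fun_id.
  by rewrite cX flip_cluster_id cards1 eqxx; ring.
case: (boolP (available X e c)) => av.
  have CE : flip_cluster X e c = [set e].
    by apply: flip_cluster_isolated => // i adj; move/forallP: av => /(_ i); rewrite adj.
  have -> : glauber_move sigma e c = flip_move sigma e c.
    apply/val_inj; rewrite /= /glauber_fun av; apply/ffunP => g; rewrite !ffunE.
    by rewrite -/X CE inE; case: (eqVneq g e) => [->|]; rewrite ?swap_color_l.
  by rewrite -/X CE cards1 eqxx /= divr1 mul1r subrr mul0r addr0.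
have -> : glauber_move sigma e c = sigma.
  by apply/val_inj; rewrite /= /glauber_fun (negbTE av).
suff -> : (#|flip_cluster X e c| == 1%N) = false by rewrite !mul0r add0r subr0 mul1r.
move: av; rewrite negb_forall => /existsP[i]; rewrite negb_imply negbK => /andP[adj /eqP Xi].
apply: gtn_eqF; apply: leq_trans (flip_cluster_card_ge nc).
by rewrite ltnS card_gt0; apply/set0Pn; exists i; rewrite inE adj Xi eqxx.
Qed.

(** With w = 1/2 the conditions [contr_both_one] and [contr_one_both] are both equalities at kappa =
    6. *)
Lemma glauber_contractive (R : realType) :
  @contractive R (fun a => (a == 1%N)%:R) 2^-1 0 0 0 6.
Proof.
split=> //=; try lra.
- by case=> [|[|a]] // _ /=; lra.
- by case=> [|[|a]].
- by case=> [|[|a]] // _; rewrite /= ?subrr ?mulr0 ?mul0r.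
- by case=> [|[|a]] // _; rewrite mulr0.
- by case=> [|[|a]] // _; rewrite mulr0.
Qed.

(* Writing [q_b = p_b - p_(b+1)], the values make [(b - 1) q_b] nearly constant *)
(* for [2 <= b <= 6], which maximises [p_2] for a given bound [r] on these.      *)
Definition flip_probs (R : realType) (a : nat) : R :=
  nth 0 [:: 0; 1; 127 / 2000; 71 / 2000; 43 / 2000; 25 / 2000; 11 / 2000] a.

Lemma flip_probsE (R : realType) :
  ((flip_probs R 0 = 0) * (flip_probs R 1 = 1) * (flip_probs R 2 = 127 / 2000) *
   (flip_probs R 3 = 71 / 2000) * (flip_probs R 4 = 43 / 2000) *
   (flip_probs R 5 = 25 / 2000) * (flip_probs R 6 = 11 / 2000) *
   (forall a, flip_probs R a.+4.+3 = 0))%type.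
Proof. by do !split=> // a; rewrite /flip_probs nth_default. Qed.

(** The bounds are attained: [r] = q_2, [mu] = 2 p_2, [rho] = 2 p_3. The weight 0.489 nearly
    balances [contr_both_one] and [contr_one_both], which force kappa; the remaining conditions have
    room. *)
Lemma flip_probs_contractive (R : realType) :
  contractive (flip_probs R) (489 / 1000) (28 / 1000) (127 / 1000) (71 / 1000)
    (5946 / 1000).
Proof.
split; rewrite ?flip_probsE; try lra.
- by case=> [|[|[|[|[|[|[|a]]]]]]]; rewrite flip_probsE; lra.
- by case=> [|[|[|[|[|[|[|a]]]]]]] h; rewrite flip_probsE; (lra || case: (notF h)).
- by case=> [|[|[|[|[|[|[|a]]]]]]] h; rewrite !flip_probsE; (lra || case: (notF h)).
- by case=> [|[|[|[|[|[|[|a]]]]]]] h; rewrite !flip_probsE ?subrr ?mulr0; (lra || case: (notF h)).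
- by case=> [|[|[|[|[|[|[|a]]]]]]] h; rewrite flip_probsE ?mulr0; (lra || case: (notF h)).
- by case=> [|[|[|[|[|[|[|a]]]]]]] h; rewrite flip_probsE ?mulr0; (lra || case: (notF h)).
Qed.

Theorem theorem1p1 (R : realType) :
  (forall delta : R, 0 < delta ->
     exists2 C : R, 0 < C &
     forall (n Delta k : nat) (V : finType) (E1 E2 : {set {set V}}),
       (1 <= n)%N -> (1 <= Delta)%N -> (0 < k)%N ->
       #|V| = n ->
       simple_graph E1 -> simple_graph E2 ->
       (max_degree E1 <= Delta)%N -> (max_degree E2 <= Delta)%N ->
       (6 + delta) * Delta%:R < k%:R ->
       (glauber_mixing_time E1 E2 k R <=
          (C * (#|E1 :|: E2|%:R * ln n%:R))%:E)%E)
  /\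
  (exists2 p : nat -> R, local_flip_probs 6 p &
     exists2 C : R, 0 < C &
     forall (n Delta k : nat) (V : finType) (E1 E2 : {set {set V}}),
       (1 <= n)%N -> (1 <= Delta)%N -> (0 < k)%N ->
       #|V| = n ->
       simple_graph E1 -> simple_graph E2 ->
       (max_degree E1 <= Delta)%N -> (max_degree E2 <= Delta)%N ->
       (* 1487 / 250 = 5.948 *)
       1487 / 250 * Delta%:R <= k%:R :> R ->
       (flip_mixing_time E1 E2 k p <=
          (C * (#|E1 :|: E2|%:R * ln n%:R))%:E)%E).
Proof.
split=> [delta d0|].
  have d6 : 0 < 6 + delta by lra.
  (* Chosen so that (1 - eta) (6 + delta) = 6. *)
  pose eta := delta / (6 + delta).
  have eta0 : 0 < eta by rewrite divr_gt0.
  exists (6 / eta + 2); first by rewrite addr_gt0 // divr_gt0.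
  move=> n Delta k V E1 E2 _ _ k0 <- s1 s2 D1 D2 hk.
  rewrite /glauber_mixing_time glauber_kernelE.
  apply: (flip_mixing_time_le (glauber_contractive R) s1 s2 D1 D2 k0).
    by rewrite eta0 ltr_pdivrMr //; lra.
  have -> : 1 - eta = 6 / (6 + delta) by rewrite /eta; field; rewrite gt_eqF.
  by rewrite mulrAC ler_pdivlMr // -mulrA ler_pM2l // mulrC ltW.
exists (flip_probs R).
  split=> [|a _|a a6]; first by rewrite flip_probsE.
    by case: a => [|[|[|[|[|[|[|a]]]]]]]; rewrite flip_probsE; lra.
  by rewrite /flip_probs nth_default.
(* Here eta = 1 / 2974, since 5.948 (1 - 1 / 2974) = 5.946 exactly. *)
exists (6 / (1 / 2974) + 2); first by lra.
move=> n Delta k V E1 E2 _ _ k0 <- s1 s2 D1 D2 hk.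
apply: (flip_mixing_time_le (flip_probs_contractive R) s1 s2 D1 D2 k0); first lra.
by lra.
Qed.
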